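(* Let $G$ be a connected graph of order $n$ with clique number $\omega$. Then $\partial^L_1(G)\leq\partial^L_1(K_\omega^{n-\omega})$, with equality if and only if $G\cong K_\omega^{n-\omega}$.
   Context: All graphs are finite, simple, undirected and connected; $d(u,v)$ is graph distance. The transmission of $v$ is $Tr(v)=\sum_u d(v,u)$; $\mathcal{L}(G)=Tr(G)-D(G)$ is the distance Laplacian matrix ($Tr(G)$ the diagonal matrix of transmissions, $D(G)$ the distance matrix), and $\partial^L_1(G)$ its largest eigenvalue. The clique number is the order of a largest clique. $K_\omega^{n-\omega}$ is the graph obtained from a clique $K_\omega$ and a path $P_{n-\omega}$ by adding one edge between an end-vertex of the path and a vertex of the clique (for $\omega=n$ it is $K_n$). *)

(* Defs.v *)
From mathcomp Require Import all_boot all_order all_algebra.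
From mathcomp Require Import boolp classical_sets reals.
From mathcomp Require Import complex polyrcf ring.

Set Implicit Arguments.
Unset Strict Implicit.
Unset Printing Implicit Defensive.

Import Order.TTheory GRing.Theory Num.Theory.

Record sgraph := SGraph {
  svertex :> finType;
  sedge : rel svertex;
  sedge_sym : symmetric sedge;
  sedge_irr : irreflexive sedge }.

Definition connected_graph (G : sgraph) : Prop :=
  0 < #|G| /\ forall x y : G, connect (@sedge G) x y.

Definition isomorphic (G H : sgraph) : Prop :=
  exists2 f : G -> H, bijective f & {mono f : x y / sedge x y}.

Definition clique (G : sgraph) (A : {set G}) : bool :=
  [forall x in A, forall y in A, (x != y) ==> sedge x y].

Definition clique_number (G : sgraph) : nat :=
  \max_(A : {set G} | clique A) #|A|.

Definition walk_of_length (G : sgraph) (x y : G) (k : nat) : bool :=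
  [exists p : k.-tuple G, path (@sedge G) x p && (last x p == y)].

(* The least k such that there is a walk of length k from x to y. Such a k is
   smaller than #|G| when x and y are connected; otherwise the value is #|G|. *)
Definition dist (G : sgraph) (x y : G) : nat :=
  find (walk_of_length x y) (iota 0 #|G|).

Lemma dist_le (G : sgraph) (x : G) (p : seq G) :
  path (@sedge G) x p -> dist x (last x p) <= size p.
Proof.
move=> xp; have [pG|Gp] := ltnP (size p) #|G|; last first.
  by apply: leq_trans Gp; rewrite -[leqRHS](size_iota 0) find_size.
rewrite leqNgt; apply/negP => /(before_find 0).
rewrite nth_iota // add0n /walk_of_length => /negbT/negP; apply.
by rewrite /walk_of_length; apply/existsP; exists (in_tuple p); rewrite xp eqxx.
Qed.

Lemma dist_walk (G : sgraph) (x y : G) : connect (@sedge G) x y ->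
  exists p, [/\ path (@sedge G) x p, last x p = y & size p = dist x y].
Proof.
move=> /connectP[p0 /shortenP[p xp up _] ->].
have pG : size p < #|G|.
  by move/card_uniqP: up => /= <-; apply: max_card.
have hasw : has (walk_of_length x (last x p)) (iota 0 #|G|).
  apply/hasP; exists (size p); first by rewrite mem_iota.
  by rewrite /walk_of_length; apply/existsP; exists (in_tuple p); rewrite xp eqxx.
have := nth_find 0 hasw; rewrite nth_iota; last by rewrite has_find size_iota in hasw.
rewrite /walk_of_length; case/existsP=> q /andP[xq /eqP lq]; exists q; split=> //.
by rewrite size_tuple add0n.
Qed.

Lemma dist_sym (G : sgraph) (x y : G) : dist x y = dist y x.
Proof.
apply: eq_find => k; rewrite /walk_of_length.
wlog suff h : x y / [exists p : k.-tuple G, path (@sedge G) x p && (last x p == y)] ->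
    [exists p : k.-tuple G, path (@sedge G) y p && (last y p == x)].
  by apply/idP/idP; apply: h.
case/existsP=> p /andP[xp /eqP lp]; apply/existsP.
have sz : size (rev (belast x p)) == k by rewrite size_rev size_belast size_tuple.
exists (Tuple sz); rewrite /= -lp rev_path.
rewrite (eq_path (e' := @sedge G)) => [|u v]; last exact: sedge_sym.
rewrite xp /=; case: (tval p) => //= a q; rewrite rev_cons last_rcons eqxx //.
Qed.

Definition transmission (G : sgraph) (v : G) : nat := \sum_(u : G) dist v u.

(* kite w m is K_w^m : the vertices inl _ form the clique K_w, the vertices
   inr _ form the path P_m in their natural order, and the added edge joins
   inl 0 to inr 0. *)
Definition kite_edge (w m : nat) (x y : 'I_w + 'I_m) : bool :=
  match x, y with
  | inl i, inl j => i != j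
  | inr i, inr j => (i.+1 == j :> nat) || (j.+1 == i :> nat)
  | inl i, inr j | inr j, inl i => (i == 0 :> nat) && (j == 0 :> nat)
  end.

Fact kite_edge_sym (w m : nat) : symmetric (@kite_edge w m).
Proof. by case=> [i|i] [j|j] //=; [rewrite eq_sym | rewrite orbC]. Qed.

Fact kite_edge_irr (w m : nat) : irreflexive (@kite_edge w m).
Proof. by case=> [i|i] /=; [rewrite eqxx | rewrite orbb gtn_eqF]. Qed.

Definition kite (w m : nat) : sgraph :=
  SGraph (@kite_edge_sym w m) (@kite_edge_irr w m).

Local Open Scope ring_scope.

Section DistanceLaplacian.
Variables (R : realType) (G : sgraph).

Definition transmission_mx : 'M[R]_#|G| :=
  diag_mx (\row_i (transmission (enum_val i))%:R).

Definition distance_mx : 'M[R]_#|G| :=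
  \matrix_(i, j) (dist (enum_val i) (enum_val j))%:R.

Definition distance_laplacian : 'M[R]_#|G| := transmission_mx - distance_mx.

End DistanceLaplacian.

Definition is_largest_eigenvalue (R : realType) (n : nat) (A : 'M[R]_n)
    (a : R) : Prop :=
  eigenvalue A a /\ forall b : R, eigenvalue A b -> b <= a.

(* By convention 0 if A has no real eigenvalue; this does not occur for a
   symmetric matrix of positive size, see largest_eigenvalueP. *)
Definition largest_eigenvalue (R : realType) (n : nat) (A : 'M[R]_n) : R :=
  xget 0 (is_largest_eigenvalue A).

Definition dist_lap_radius (R : realType) (G : sgraph) : R :=
  largest_eigenvalue (distance_laplacian R G).

Lemma largest_eigenvalueP (R : realType) (n : nat) (A : 'M[R]_n) :
  (0 < n)%N -> A^T = A -> is_largest_eigenvalue A (largest_eigenvalue A).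
Proof.
case: n A => // n A _ symA.
have [a0 eigA] : exists a, eigenvalue A a.
  pose toC := real_complex R; pose B := map_mx toC A.
  have [z] : exists z, root (char_poly B) z.
    by apply/closed_rootP; rewrite size_char_poly.
  rewrite -eigenvalue_root_char => eigB.
  suff [a za] : exists a, z = toC a.
    by exists a; move: eigB; rewrite za eigenvalue_map.
  have /eigenvalueP[v vB v0] := eigB.
  pose vc := (map_mx (@conjc R) v)^T.
  have BE : B^T = B by apply/matrixP=> i j; rewrite !mxE -[in LHS]symA mxE.
  have Bc : map_mx (@conjc R) B = B.
    by apply/matrixP=> i j; rewrite !mxE /= oppr0.
  have e1 : v *m B *m vc = z *: (v *m vc) by rewrite vB scalemxAl.
  have e2 : v *m B *m vc = conjc z *: (v *m vc).
    rewrite -mulmxA -{1}BE -trmx_mul -[B in map_mx _ v *m B]Bc.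
    by rewrite -map_mxM vB map_mxZ linearZ /= -scalemxAr.
  have nz : (v *m vc) 0 0 != 0.
    have vv i : v 0 i * vc i 0 = toC (complex.Re (v 0 i) ^+ 2 + complex.Im (v 0 i) ^+ 2).
      by rewrite !mxE; case: (v 0 i) => c d; apply/eqP; rewrite eq_complex /=;
         apply/andP; split; apply/eqP; ring.
    rewrite mxE (eq_bigr _ (fun i _ => vv i)) -(rmorph_sum toC) fmorph_eq0.
    rewrite psumr_eq0 => [|i _]; last by rewrite addr_ge0 ?sqr_ge0.
    apply: contra v0 => /allP v0; apply/eqP/rowP => i.
    have /= := v0 i (mem_index_enum _).
    rewrite paddr_eq0 ?sqr_ge0 // !sqrf_eq0 mxE.
    by case: (v 0 i) => c d /= /andP[/eqP-> /eqP->].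
  have : z = conjc z.
    move/matrixP: (etrans (esym e1) e2) => /(_ 0 0).
    by rewrite [LHS]mxE [RHS]mxE => /(mulIf nz).
  case: z {eigB vB e1 e2} => a b [/eqP]; rewrite -addr_eq0 -mulr2n mulrn_eq0 /=.
  by move=> /eqP ->; exists a.
have p0 : char_poly A != 0 by rewrite monic_neq0 ?char_poly_monic.
have memE b : (b \in rootsR (char_poly A)) = eigenvalue A b.
  by rewrite -(roots_on_rootsR p0) eigenvalue_root_char.
suff aP : exists a, is_largest_eigenvalue A a.
  exact: (xgetPex 0 (P := is_largest_eigenvalue A) aP).
set s := rootsR _ in memE.
pose a := \big[Num.max/a0]_(x <- s) x.
have as_ : a \in s.
  rewrite /a big_seq; elim/big_ind: _ => //; first by rewrite memE.
  by move=> x y xs ys; rewrite /Num.max; case: ifP.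
exists a; split; first by rewrite -memE.
move=> b; rewrite -memE => bs; exact: (le_bigmax_seq _ b xpredT id).
Qed.

Lemma dist_lap_radiusP (R : realType) (G : sgraph) : (0 < #|G|)%N ->
  is_largest_eigenvalue (distance_laplacian R G) (dist_lap_radius R G).
Proof.
move=> G0; apply: largest_eigenvalueP => //.
by rewrite /distance_laplacian linearB /= tr_diag_mx; congr (_ - _);
  apply/matrixP=> i j; rewrite !mxE dist_sym.
Qed.

(* Main.v *)
Require Import Defs.
From mathcomp Require Import all_boot all_order all_algebra.
From mathcomp Require Import reals.
From mathcomp Require Import complex ring lra zify.

(** For a symmetric matrix the largest eigenvalue is the maximum of the Rayleigh
    quotient, and for the distance Laplacian the quadratic form is
    [\sum_{u,v} d(u,v) (x_u - x_v)^2 / 2]. So it is enough to relabel the vertices of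
    [G] as those of the kite in such a way that this weighted sum of distances
    does not decrease, and this works for every nonnegative symmetric weight
    [w(u,v)].

    Replacing the distances by those in a maximum clique with pendant trees
    increases the sum, which becomes a sum of cuts [c(S) = \sum_{u in S, v notin S}
    w(u,v)], one for every edge. Sliding the attachment point of a graph along a
    path changes the sum of cuts in a convex way, the second difference being
    twice the weight between a vertex of the path and the complement of the
    path. So the sum does not decrease when the attachment point is moved to the
    better of the two ends: pendant paths can be merged two by two, first into pendant
    paths at the clique vertices, and then into a single one.

    In case of equality the relabelled eigenvector of [G] is one of the kite, and
    either some slide was not trivial, which makes [omega] of its entries equal,
    or [d_G <= d_K] pointwise, with equality where the entries differ. But a top
    eigenvector of the kite takes equal values only on the clique vertices other
    than the root: it is constant on those, and is otherwise a top eigenvector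
    of a weighted path, which is strictly monotone because its partial sums have
    constant sign, as for the ground state of a Dirichlet problem. *)

Set Implicit Arguments.
Unset Strict Implicit.
Unset Printing Implicit Defensive.

Import Order.TTheory GRing.Theory Num.Theory Num.Def.
Local Open Scope ring_scope.

(** * The Rayleigh quotient *)

Section Rayleigh.
Local Open Scope sesquilinear_scope.

(** Over the complex numbers [A] is Hermitian, hence unitarily diagonalisable with real eigenvalues
    [d i], each of them an eigenvalue of [A] and so at most [a]. In the coordinates [y] of the
    eigenbasis the deficit is the sum of the [(a - d i) |y_i|^2]. *)
Lemma rayleigh_le (R : realType) (n : nat) (A : 'M[R]_n) (a : R) :
  A^T = A -> is_largest_eigenvalue A a ->
  forall x : 'rV[R]_n, (x *m A *m x^T) 0 0 <= a * (x *m x^T) 0 0.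
Proof.
move=> symA [_ maxa] x.
pose toC := real_complex R; pose B := map_mx toC A; pose z := map_mx toC x.
have conj_toC (c : R) : conjC (toC c) = toC c.
  by apply/CrealP; rewrite complex_real.
have hB : B \is hermsymmx.
  apply: realsym_hermsym; last first.
    by apply/mxOverP => i j; rewrite mxE complex_real.
  apply/is_hermitianmxP; rewrite expr0 scale1r.
  by apply/matrixP => i j; rewrite !mxE -[in LHS]symA mxE.
have /orthomx_spectralP BE := hermitian_normalmx hB.
set P := spectralmx B in BE; set D := spectral_diag B in BE.
have uP : P \is unitarymx := spectral_unitarymx B.
have DR i : D 0 i \is Num.real by have /mxOverP := hermitian_spectral_diag_real hB.
pose d i := complex.Re (D 0 i).
have Dd i : D 0 i = toC (d i).
  by rewrite /toC /= RRe_real.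
have da i : d i <= a.
  apply: maxa; suff: eigenvalue B (D 0 i) by rewrite Dd eigenvalue_map.
  apply/eigenvalueP.
  (* The rows of the unitary matrix are the eigenvectors. *)
  exists (row i P); last first.
    apply/negP => /eqP r0; have := row_unitarymxP uP i i.
    rewrite r0 dotmxE mul0mx mxE eqxx.
    by move/eqP; rewrite eq_sym oner_eq0.
  rewrite BE invmx_unitary // !mulmxA -row_mul (unitarymxP uP).
  rewrite row1 -rowE -row_mul.
  apply/rowP => j; rewrite !mxE (bigD1 i) //= big1 => [|k ki].
    by rewrite !mxE eqxx mulr1n addr0.
  by rewrite !mxE eq_sym (negPf ki) mulr0n mul0r.
have zT : z^t* = z^T by apply/matrixP => i j; rewrite !mxE conj_toC.
pose y := z *m P^t*.
have zE : z *m z^T = y *m y^t*.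
  rewrite /y trmx_mul map_mxM trmxCK !mulmxA mulmxKtV ?trmxC_unitary //.
  by rewrite zT.
have zBE : z *m B *m z^T = y *m diag_mx D *m y^t*.
  rewrite BE invmx_unitary // /y trmx_mul map_mxM trmxCK !mulmxA.
  by rewrite zT.
move: y zE zBE => {}y zE zBE.
have e1 : toC ((x *m x^T) 0 0) = (y *m y^t*) 0 0.
  by rewrite -zE map_trmx -map_mxM [RHS]mxE.
have e2 : toC ((x *m A *m x^T) 0 0) = (y *m diag_mx D *m y^t*) 0 0.
  by rewrite -zBE map_trmx -!map_mxM [RHS]mxE.
have e3 : toC (a * (x *m x^T) 0 0 - (x *m A *m x^T) 0 0) =
    \sum_i toC (a - d i) * (y 0 i * conjC (y 0 i)).
  have -> : forall u v, toC (a * u - v) = toC a * toC u - toC v.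
    by move=> u v; rewrite /toC rmorphB rmorphM.
  rewrite e1 e2 !mxE mulr_sumr -sumrB.
  apply: eq_bigr => i _; rewrite mul_mx_diag !mxE Dd.
  have -> : toC (a - d i) = toC a - toC (d i) by rewrite /toC rmorphB.
  by rewrite mulrBl; congr (_ - _); rewrite mulrAC mulrC.
rewrite -subr_ge0 -lecR -[X in _ <= X]/(toC _) e3 sumr_ge0 // => i _.
by rewrite mulr_ge0 ?mul_conjC_ge0 // lecR subr_ge0.
Qed.

End Rayleigh.

(** * Laplacian quadratic forms and their maximizers *)

Section Forms.
Variables (R : realType) (V : finType).
Implicit Types (D : V -> V -> R) (om : V -> R) (X Y : V -> R).

(** Ordered pairs are summed, so this is twice the usual Laplacian form; hence the factors [2 * l]
    below. *)
Definition lap_form D X : R := \sum_u \sum_v D u v * (X u - X v) ^+ 2.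

Definition lap_bilin D X Y : R :=
  \sum_u \sum_v D u v * ((X u - X v) * (Y u - Y v)).

Lemma lap_form_add D X Y (t : R) :
  lap_form D (fun u => X u + t * Y u) =
  lap_form D X + t * (2 * lap_bilin D X Y) + t ^+ 2 * lap_form D Y.
Proof.
rewrite /lap_form /lap_bilin !mulr_sumr -!big_split; apply: eq_bigr => u _ /=.
rewrite !mulr_sumr -!big_split; apply: eq_bigr => v _ /=; ring.
Qed.

Lemma lap_bilinE D X Y : (forall u v, D u v = D v u) ->
  lap_bilin D X Y = 2 * \sum_u Y u * \sum_v D u v * (X u - X v).
Proof.
move=> Dsym; rewrite mulr_natl mulr2n.
transitivity (\sum_u \sum_v (D u v * (X u - X v) * Y u
                       + D u v * (X v - X u) * Y v)).
  by apply: eq_bigr => u _; apply: eq_bigr => v _; ring.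
under eq_bigr => u _ do rewrite big_split /=.
rewrite big_split /=; congr (_ + _).
  by apply: eq_bigr => u _; rewrite mulr_sumr; apply: eq_bigr => v _; rewrite mulrC.
rewrite exchange_big; apply: eq_bigr => v _; rewrite mulr_sumr.
by apply: eq_bigr => u _; rewrite mulrC Dsym.
Qed.

Lemma lap_formE D X : (forall u v, D u v = D v u) ->
  lap_form D X = 2 * \sum_u X u * \sum_v D u v * (X u - X v).
Proof.
by move=> Dsym; rewrite -lap_bilinE //; apply: eq_bigr => u _; apply: eq_bigr.
Qed.

(** Near 0 the linear term dominates: for [k] positive and larger than [c], the value at
    [t = - b / k] is a negative multiple of [b ^+ 2]. *)
Lemma quadratic_ge0_linear0 (b c : R) :
  (forall t : R, 0 <= t * b + t ^+ 2 * c) -> b = 0.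
Proof.
move=> H; pose k := `|c| + 1.
have k0 : 0 < k by rewrite ltr_wpDl.
have ck : c < k by rewrite /k (le_lt_trans (ler_norm c)) // ltrDl.
have := H (- b / k).
have -> : - b / k * b + (- b / k) ^+ 2 * c = - (b ^+ 2 * ((k - c) / k ^+ 2)).
  by field; rewrite gt_eqF.
rewrite oppr_ge0 pmulr_lle0; last by rewrite divr_gt0 ?subr_gt0 ?exprn_gt0.
by move=> b0; apply/eqP; rewrite -sqrf_eq0 eq_le b0 sqr_ge0.
Qed.

(** First-order condition: perturbing [X] along the indicator of [u], the deficit is a nonnegative
    quadratic in [t] without constant term, so its linear coefficient vanishes. The vertex weights
    [om] let this serve both the kite, with weights 1, and the weighted path. *)
Lemma maximizer_eigenvector D om (l : R) X : (forall u v, D u v = D v u) ->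
  (forall Y, lap_form D Y <= 2 * l * \sum_u om u * Y u ^+ 2) ->
  lap_form D X = 2 * l * \sum_u om u * X u ^+ 2 ->
  forall u, l * (om u * X u) = \sum_v D u v * (X u - X v).
Proof.
move=> Dsym lmax lX u.
pose Y v : R := (v == u)%:R.
have H (t : R) : 0 <= t * (4 * (l * (om u * X u) - \sum_v D u v * (X u - X v))) +
    t ^+ 2 * (2 * l * (\sum_v om v * Y v ^+ 2) - lap_form D Y).
  have := lmax (fun v => X v + t * Y v); rewrite lap_form_add lX lap_bilinE //.
  have -> : \sum_v om v * (X v + t * Y v) ^+ 2 =
      \sum_v om v * X v ^+ 2 + t * (2 * (om u * X u)) + t ^+ 2 * \sum_v om v * Y v ^+ 2.
    transitivity (\sum_v (om v * X v ^+ 2 + t * (2 * (om v * X v * Y v)) +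
        t ^+ 2 * (om v * Y v ^+ 2))).
      by apply: eq_bigr => v _; ring.
    rewrite !big_split /= -!mulr_sumr; congr (_ + _ * (_ * _) + _).
    rewrite (bigD1 u) //= /Y eqxx mulr1 big1 ?addr0 // => v /negPf ->.
    by rewrite mulr0.
  have -> : \sum_v Y v * (\sum_v' D v v' * (X v - X v')) =
            \sum_v' D u v' * (X u - X v').
    rewrite (bigD1 u) //= /Y eqxx mul1r [X in _ + X]big1 ?addr0 // => v /negPf ->.
    by rewrite mul0r.
  lra.
have /eqP := quadratic_ge0_linear0 H.
by rewrite mulf_eq0 pnatr_eq0 /= subr_eq0 => /eqP.
Qed.

End Forms.

(** * The spectral radius as a maximum of the quadratic form *)

Section Radius.
Variables (R : realType) (G : sgraph).

Local Notation dform := (lap_form (fun u v : G => (dist u v)%:R)).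

Lemma distance_laplacian_form (x : 'rV[R]_#|G|) :
  2 * (x *m distance_laplacian R G *m x^T) 0 0 =
  dform (fun u => x 0 (enum_rank u)).
Proof.
rewrite lap_formE; last by move=> u v; rewrite dist_sym.
congr (_ * _); rewrite !mxE.
rewrite (reindex (@enum_rank G)) /=; last exact/onW_bij/enum_rank_bij.
apply: eq_bigr => u _; rewrite [RHS]mulrC !mxE; congr (_ * _).
rewrite (reindex (@enum_rank G)) /=; last exact/onW_bij/enum_rank_bij.
under [RHS]eq_bigr => v _ do rewrite mulrBr.
under eq_bigr => v _ do rewrite !mxE !enum_rankK mulrBr.
rewrite !sumrB; congr (_ - _); last first.
  by apply: eq_bigr => v _; rewrite mulrC dist_sym.
rewrite (bigD1 u) //= eqxx mulr1n big1 ?addr0; last first.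
  by move=> v vu; rewrite (inj_eq enum_rank_inj) (negPf vu) mulr0n mulr0.
by rewrite mulrC -mulr_suml /transmission natr_sum.
Qed.

Lemma radius_form_le (X : G -> R) : (0 < #|G|)%N ->
  dform X <= 2 * dist_lap_radius R G * \sum_u X u ^+ 2.
Proof.
move=> G0; pose x : 'rV[R]_#|G| := \row_i X (enum_val i).
have symL : (distance_laplacian R G)^T = distance_laplacian R G.
  by rewrite /distance_laplacian linearB /= tr_diag_mx; congr (_ - _);
    apply/matrixP => i j; rewrite !mxE dist_sym.
have := rayleigh_le symL (dist_lap_radiusP R G0) x.
rewrite -(ler_pM2l (ltr0n R 2)) distance_laplacian_form mulrA.
congr (_ <= _ * _).
  by apply: eq_bigr => u _; apply: eq_bigr => v _; rewrite !mxE !enum_rankK.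
rewrite !mxE (reindex (@enum_rank G)) /=; last exact/onW_bij/enum_rank_bij.
by apply: eq_bigr => u _; rewrite !mxE enum_rankK expr2.
Qed.

Lemma radius_form_attained : (0 < #|G|)%N ->
  exists2 X : G -> R, 0 < \sum_u X u ^+ 2 &
    dform X = 2 * dist_lap_radius R G * \sum_u X u ^+ 2.
Proof.
move=> G0; have [/eigenvalueP[x xL x0] _] := dist_lap_radiusP R G0.
exists (fun u => x 0 (enum_rank u)).
  rewrite lt0r sumr_ge0 ?andbT => [|u _]; last exact: sqr_ge0.
  apply: contra x0; rewrite psumr_eq0 => [/allP z0|u _]; last exact: sqr_ge0.
  apply/eqP/rowP => i; have := z0 (enum_val i) (mem_index_enum _).
  by rewrite /= sqrf_eq0 enum_valK mxE => /eqP.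
rewrite -distance_laplacian_form xL -scalemxAl mxE mulrA; congr (_ * _).
rewrite !mxE (reindex (@enum_rank G)) /=; last exact/onW_bij/enum_rank_bij.
by apply: eq_bigr => u _; rewrite !mxE expr2.
Qed.

End Radius.

(** * Top eigenvectors of weighted paths *)

(** This is [|i - j|]: at least one of the two truncated differences is 0. *)
Definition natdist (i j : nat) : nat := ((i - j) + (j - i))%N.

Section WeightedPath.
Variables (R : realType) (N : nat) (om : nat -> R) (l : R).
Hypothesis om_gt0 : forall i, 0 < om i.
Hypothesis N_gt1 : (1 < N)%N.
Implicit Types (f : nat -> R).

(** Distances in a path whose vertex [i] stands for [om i] vertices carrying the same value. *)
Definition line_mx (i j : 'I_N) : R := om i * om j * (natdist i j)%:R.

Local Notation lform f := (lap_form line_mx (fun i : 'I_N => f i)).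
Local Notation lnorm f := (\sum_(i < N) om i * f i ^+ 2).
Local Notation below f k := (\sum_(j < k) om j * f j).

Definition line_tr (i : nat) : R := \sum_(j < N) om j * (natdist i j)%:R.

Lemma natdist_sym i j : natdist i j = natdist j i.
Proof. exact: addnC. Qed.

Lemma natdistS i j : (natdist i.+1 j)%:R =
  (natdist i j)%:R + (2 * (j < i.+1)%N%:R - 1) :> R.
Proof.
have : (natdist i.+1 j + 1 = natdist i j + 2 * (j < i.+1))%N.
  by rewrite /natdist; lia.
move/(congr1 (@GRing.natmul R 1)); rewrite natrD [in RHS]natrD [in RHS]natrM; lra.
Qed.

Lemma sum_below (k : nat) (F : nat -> R) : (k <= N)%N ->
  \sum_(j < N) (j < k)%N%:R * F j = \sum_(j < k) F j.
Proof.
move=> kN; rewrite (big_ord_widen N F kN) [RHS]big_mkcond.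
by apply: eq_bigr => j _; case: ifP; rewrite ?mul1r ?mul0r.
Qed.

(** The distance counts the cuts of the path that separate [i] from [j]; each summand is the
    exclusive or of two indicators. *)
Lemma natdist_cuts (i j : 'I_N) : (natdist i j)%:R =
  \sum_(k < N) ((i < k)%N%:R + (j < k)%N%:R - 2 * ((i < k)%N%:R * (j < k)%N%:R)) :> R.
Proof.
transitivity ((\sum_(k < N) ((i < k) != (j < k)))%N%:R : R); last first.
  rewrite natr_sum; apply: eq_bigr => k _.
  by case: (i < k)%N; case: (j < k)%N => /=; lra.
congr (_%:R); wlog ij : i j / (i <= j)%N.
  move=> H; case: (leqP i j) => [|/ltnW] ij; first exact: H.
  rewrite natdist_sym H //; apply: eq_bigr => k _; by rewrite eq_sym.
transitivity (\sum_(k < N) (i < k <= j))%N.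
  rewrite -(big_mkord xpredT (fun k => (i < k <= j)%N : nat)).
  rewrite (big_cat_nat (n := i.+1)) //= (big_cat_nat (m := i.+1) (n := j.+1)) //=.
  rewrite big1_seq ?add0n; last by move=> k; rewrite mem_index_iota; lia.
  rewrite [X in (_ + X)%N]big1_seq ?addn0; last by move=> k; rewrite mem_index_iota; lia.
  rewrite (eq_big_seq (fun=> 1%N)) ?sum_nat_const_nat /natdist; first by lia.
  by move=> k; rewrite mem_index_iota; lia.
by apply: eq_bigr => k _; lia.
Qed.

(** Expanding the square leaves the transmission terms and a cross term. By [natdist_cuts] the
    latter splits over the cuts, and as [om * f] has total 0, the cut at [k] contributes
    [- 2 * below f k ^+ 2]. *)
Lemma line_formE f : below f N = 0 ->
  lform f = 2 * (\sum_(i < N) om i * line_tr i * f i ^+ 2)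
          + 4 * \sum_(k < N) below f k ^+ 2.
Proof.
move=> f0.
have E (k : nat) : (k <= N)%N ->
    \sum_(i < N) (i < k)%N%:R * (om i * f i) = below f k.
  exact: (sum_below (fun i => om i * f i)).
have cross : \sum_(i < N) \sum_(j < N)
    (natdist i j)%:R * (om i * f i) * (om j * f j) =
    - 2 * \sum_(k < N) below f k ^+ 2.
  transitivity (\sum_(k < N) \sum_(i < N) \sum_(j < N)
    ((i < k)%N%:R + (j < k)%N%:R - 2 * ((i < k)%N%:R * (j < k)%N%:R))
     * (om i * f i) * (om j * f j)).
    rewrite [RHS]exchange_big; apply: eq_bigr => i _.
    rewrite [RHS]exchange_big; apply: eq_bigr => j _.
    by rewrite natdist_cuts !mulr_suml.
  rewrite mulr_sumr; apply: eq_bigr => k _.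
  transitivity (\sum_(i < N) ((i < k)%N%:R * (om i * f i) * below f N +
      (om i * f i) * below f k - 2 * ((i < k)%N%:R * (om i * f i)) * below f k)).
    apply: eq_bigr => i _; rewrite -!(E k) ?(ltnW (ltn_ord k)) //.
    by rewrite !mulr_sumr -big_split -sumrB; apply: eq_bigr => j _ /=; ring.
  rewrite sumrB big_split /= -!mulr_suml -mulr_sumr E ?(ltnW (ltn_ord k)) //.
  rewrite f0; ring.
transitivity (\sum_(i < N) \sum_(j < N) (om i * f i ^+ 2 * (om j * (natdist i j)%:R)
   + om j * f j ^+ 2 * (om i * (natdist j i)%:R)
   - 2 * ((natdist i j)%:R * (om i * f i) * (om j * f j)))).
  apply: eq_bigr => i _; apply: eq_bigr => j _.
  rewrite /line_mx [natdist j i]natdist_sym; ring.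
under eq_bigr => i _ do rewrite sumrB big_split /= -mulr_sumr -mulr_sumr.
rewrite sumrB big_split /= -mulr_sumr cross.
have -> : \sum_(i < N) \sum_(j < N) om j * f j ^+ 2 * (om i * (natdist j i)%:R) =
    \sum_(i < N) om i * f i ^+ 2 * \sum_(j < N) om j * (natdist i j)%:R.
  by rewrite exchange_big; apply: eq_bigr => i _; rewrite mulr_sumr.
have -> : \sum_(i < N) om i * f i ^+ 2 * \sum_(j < N) om j * (natdist i j)%:R =
   \sum_(i < N) om i * line_tr i * f i ^+ 2.
  by apply: eq_bigr => i _; rewrite mulrAC.
lra.
Qed.

Hypothesis lmax : forall f, lform f <= 2 * l * lnorm f.

Lemma line_tr_gt0 i : (i < N)%N -> 0 < line_tr i.
Proof.
move=> iN; have [j ij] : exists j : 'I_N, natdist i j != 0%N.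
  case: i iN => [|i] iN; first by exists (Ordinal N_gt1).
  by exists (Ordinal (ltnW N_gt1)); rewrite /natdist /=; lia.
rewrite /line_tr (bigD1 j) //= ltr_wpDr ?mulr_gt0 ?ltr0n ?lt0n //.
by apply: sumr_ge0 => k _; rewrite mulr_ge0 ?ler0n ?ltW.
Qed.

(** The test function is the indicator of [i] minus its weighted mean [c]. Its form is
    [2 * om i * line_tr i] and its norm [om i * (1 - c)], whence [line_tr i <= l * (1 - c)]. *)
Lemma line_tr_lt i : (i < N)%N -> line_tr i < l.
Proof.
move=> iN; pose W := \sum_(j < N) om j.
have omW : om i < W.
  rewrite /W (bigD1 (Ordinal iN)) //= ltrDl.
  have [j ij] : exists j : 'I_N, j != Ordinal iN.
    case: (i =P 0%N) => [i0|/eqP i0].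
      by exists (Ordinal N_gt1); rewrite -val_eqE /= i0.
    by exists (Ordinal (ltnW N_gt1)); rewrite -val_eqE /= eq_sym.
  by rewrite (bigD1 j) //= ltr_wpDr // sumr_ge0 // => k _; exact: ltW.
have W0 : 0 < W := lt_trans (om_gt0 i) omW.
pose c := om i / W; pose e (j : nat) : R := (j == i)%:R - c.
have := lmax e.
have -> : lform e = 2 * (om i * line_tr i).
  rewrite lap_formE; last by move=> u v; rewrite /line_mx natdist_sym; ring.
  pose Le (j : 'I_N) := \sum_(k < N) line_mx j k * (e j - e k).
  transitivity (2 * \sum_(j < N) (j == i :> nat)%:R * Le j).
    transitivity (2 * ((\sum_(j < N) (j == i :> nat)%:R * Le j)
      - c * \sum_(j < N) Le j)).
      rewrite [c * _]mulr_sumr -sumrB; congr (_ * _).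
      by apply: eq_bigr => j _; rewrite -mulrBl.
    (* The summand is antisymmetric, so the constant part of [e] does not contribute. *)
    have : \sum_(j < N) Le j = - \sum_(j < N) Le j.
      rewrite [LHS]exchange_big -sumrN; apply: eq_bigr => j _.
      by rewrite -sumrN; apply: eq_bigr => k _; rewrite /line_mx natdist_sym; ring.
    move=> H; have -> : \sum_(j < N) Le j = 0 by lra.
    by rewrite mulr0 subr0.
  congr (_ * _); rewrite (bigD1 (Ordinal iN)) //= eqxx mul1r [X in _ + X]big1 ?addr0.
    rewrite /line_tr mulr_sumr; apply: eq_bigr => k _.
    rewrite /e /line_mx /= eqxx.
    case: eqP => [<-|_]; first by rewrite /natdist subnn !mulr0 !mul0r.
    by rewrite /=; ring.
  by move=> j; rewrite -val_eqE /= => /negPf ->; rewrite mul0r.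
have -> : lnorm e = om i * (1 - c).
  transitivity (\sum_(j < N) ((j == i :> nat)%:R * (om j * (1 - 2 * c)) + om j * c ^+ 2)).
    apply: eq_bigr => j _; rewrite /e; case: eqP => _ /=; ring.
  rewrite big_split /= -mulr_suml -/W (bigD1 (Ordinal iN)) //= eqxx mul1r.
  rewrite [X in _ + X + _]big1 ?addr0; last first.
    by move=> j; rewrite -val_eqE /= => /negPf ->; rewrite mul0r.
  by rewrite /c; field; rewrite gt_eqF.
rewrite -mulrA ler_pM2l // mulrCA ler_pM2l // => H.
have T0 := line_tr_gt0 iN.
have c0 : 0 < c by rewrite divr_gt0.
have c1 : 0 < 1 - c by rewrite subr_gt0 ltr_pdivrMr // mul1r.
have l0 : 0 < l by rewrite -(pmulr_lgt0 _ c1) (lt_le_trans T0).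
by apply: (le_lt_trans H); rewrite mulrBr mulr1 ltrBlDr ltrDl mulr_gt0.
Qed.

Section Maximizer.
Variable f : nat -> R.
Hypothesis fmax : lform f = 2 * l * lnorm f.

Lemma line_eigen i : (i < N)%N ->
  l * f i = \sum_(j < N) om j * (natdist i j)%:R * (f i - f j).
Proof.
move=> iN; have lm (Y : 'I_N -> R) :
    lap_form line_mx Y <= 2 * l * \sum_(u < N) om u * Y u ^+ 2.
  (* [lmax] quantifies over functions on all naturals; the extension by 0 is never evaluated beyond
     [N]. *)
  have := lmax (fun j => if insub j is Some k then Y k else 0).
  by congr (_ <= _ * _); apply: eq_bigr => u _; first apply: eq_bigr => v _;
    rewrite !valK.
have sym (u v : 'I_N) : line_mx u v = line_mx v u by rewrite /line_mx natdist_sym; ring.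
have H := maximizer_eigenvector sym lm fmax (Ordinal iN).
apply: (mulfI (lt0r_neq0 (om_gt0 i))); rewrite mulrCA H /=.
by rewrite mulr_sumr; apply: eq_bigr => j _; rewrite /line_mx /= !mulrA.
Qed.

Lemma line_balance : below f N = 0.
Proof.
have l0 : 0 < l.
  exact: lt_trans (line_tr_gt0 (ltnW N_gt1)) (line_tr_lt (ltnW N_gt1)).
suff H : l * below f N = - (l * below f N).
  by apply: (mulfI (lt0r_neq0 l0)); rewrite mulr0; lra.
have -> : l * below f N =
    \sum_(i < N) \sum_(j < N) om i * om j * (natdist i j)%:R * (f i - f j).
  rewrite mulr_sumr; apply: eq_bigr => i _; rewrite mulrCA line_eigen // mulr_sumr.
  by apply: eq_bigr => j _; rewrite !mulrA.
rewrite [LHS]exchange_big -sumrN; apply: eq_bigr => i _.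
by rewrite -sumrN; apply: eq_bigr => j _; rewrite natdist_sym; ring.
Qed.

(** The eigenvalue equation reads [(l - line_tr k) * f k = - \sum om j * natdist k j * f j]. Between
    neighbours each distance changes by 1, up for [j <= i] and down otherwise, and [line_balance]
    removes the total. *)
Lemma line_potential i : (i.+1 < N)%N ->
  (l - line_tr i) * f i - (l - line_tr i.+1) * f i.+1 = 2 * below f i.+1.
Proof.
move=> iN.
have E k : (k < N)%N ->
    (l - line_tr k) * f k = - \sum_(j < N) om j * (natdist k j)%:R * f j.
  move=> kN; rewrite mulrBl line_eigen // /line_tr mulr_suml -sumrB -sumrN.
  by apply: eq_bigr => j _; ring.
rewrite !E ?(ltnW iN) // opprK addrC -sumrB.
transitivity (\sum_(j < N) (2 * ((j < i.+1)%N%:R * (om j * f j)) - om j * f j)).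
  by apply: eq_bigr => j _; rewrite natdistS; ring.
rewrite sumrB -mulr_sumr (sum_below (fun j => om j * f j)) ?(ltnW iN) //.
by rewrite line_balance subr0.
Qed.

(** In this form the increment at [i] is visibly negative when [f i] is positive and is the least
    value so far. [line_step_left] is the mirror image, for negative values. *)
Lemma line_step_right i : (i.+1 < N)%N ->
  (l - line_tr i.+1) * (f i.+1 - f i) =
  - (\sum_(j < N) om j) * f i + 2 * \sum_(j < i.+1) om j * (f i - f j).
Proof.
move=> iN; have H := line_potential iN.
have T : line_tr i.+1 - line_tr i = 2 * (\sum_(j < i.+1) om j) - \sum_(j < N) om j.
  rewrite /line_tr -sumrB -(sum_below om (ltnW iN)) mulr_sumr -sumrB.
  by apply: eq_bigr => j _; rewrite natdistS; ring.
have -> : \sum_(j < i.+1) om j * (f i - f j) =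
    (\sum_(j < i.+1) om j) * f i - below f i.+1.
  by rewrite mulr_suml -sumrB; apply: eq_bigr => j _; rewrite mulrBr.
nra.
Qed.

Lemma line_step_left i : (i.+1 < N)%N ->
  (l - line_tr i) * (f i - f i.+1) =
  - (\sum_(j < N) om j) * f i.+1 +
  2 * \sum_(j < N) (i < j)%N%:R * (om j * (f i.+1 - f j)).
Proof.
move=> iN; have H := line_potential iN.
have T : line_tr i.+1 - line_tr i = 2 * (\sum_(j < i.+1) om j) - \sum_(j < N) om j.
  rewrite /line_tr -sumrB -(sum_below om (ltnW iN)) mulr_sumr -sumrB.
  by apply: eq_bigr => j _; rewrite natdistS; ring.
have -> : \sum_(j < N) (i < j)%N%:R * (om j * (f i.+1 - f j)) =
    (\sum_(j < N) om j) * f i.+1 - below f N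
    - ((\sum_(j < i.+1) om j) * f i.+1 - below f i.+1).
  rewrite -(sum_below om (ltnW iN)) -(sum_below (fun j => om j * f j) (ltnW iN)).
  rewrite !mulr_suml -!sumrB; apply: eq_bigr => j _; rewrite ltnNge -ltnS.
  by case: (j < i.+1)%N => /=; ring.
rewrite line_balance; nra.
Qed.

End Maximizer.

(** A strong maximum principle. At an interior zero of the nonnegative partial sums, the adjacent
    values satisfy [f i <= 0 <= f i.+1], while [line_potential] makes them positive multiples of
    each other; so both vanish, and the zero spreads to the two neighbouring sums and then
    everywhere. *)
Lemma line_below_gt0 f : lform f = 2 * l * lnorm f ->
  (exists2 i, (i < N)%N & f i != 0) ->
  (forall k, (k <= N)%N -> 0 <= below f k) ->
  forall k, (0 < k < N)%N -> 0 < below f k.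
Proof.
move=> fmax [i0 i0N fi0] G_ge0.
have stepG i : om i * f i = below f i.+1 - below f i.
  by rewrite big_ord_recr /= addrAC subrr add0r.
have zero i : (i.+1 < N)%N -> below f i.+1 = 0 -> below f i = 0 /\ below f i.+2 = 0.
  move=> iN Gi0; have := line_potential fmax iN; rewrite Gi0 mulr0 => /eqP.
  rewrite subr_eq0 => /eqP P.
  have m0 : 0 < l - line_tr i by rewrite subr_gt0 line_tr_lt // ltnW.
  have m1 : 0 < l - line_tr i.+1 by rewrite subr_gt0 line_tr_lt.
  have fi : f i <= 0.
    by rewrite -(pmulr_rle0 _ (om_gt0 i)) stepG Gi0 sub0r oppr_le0 G_ge0 // ltnW // ltnW.
  have fi1 : 0 <= f i.+1.
    by rewrite -(pmulr_rge0 _ (om_gt0 i.+1)) stepG Gi0 subr0 G_ge0.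
  have e0 : f i = 0.
    apply/eqP; rewrite eq_le fi -(pmulr_rge0 _ m0) P.
    by rewrite mulr_ge0 // ltW.
  have e1 : f i.+1 = 0.
    by move/eqP: P; rewrite e0 mulr0 eq_sym mulf_eq0 gt_eqF //= => /eqP.
  have := stepG i; have := stepG i.+1; rewrite e0 e1 Gi0 !mulr0.
  by split; lra.
move=> k /andP[k0 kN]; rewrite lt0r G_ge0 ?(ltnW kN) // andbT.
apply: contraNneq fi0 => Gk.
have down j : (j <= k)%N -> below f (k - j) = 0.
  elim: j => [|j IH] jk; first by rewrite subn0.
  have := IH (ltnW jk); rewrite -(subnSK jk) => H.
  have kjN : ((k - j.+1).+1 < N)%N by lia.
  by have [] := zero _ kjN H.
have up j : (k + j <= N)%N -> below f (k + j) = 0.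
  elim: j => [|j IH] jN; first by rewrite addn0.
  rewrite addnS in jN *; have kj : ((k + j).-1.+1 = k + j)%N by lia.
  have := IH (ltnW jN); rewrite -kj => Gj.
  have kjN : ((k + j).-1.+1 < N)%N by rewrite kj.
  by have [] := zero _ kjN Gj.
have all0 j : (j <= N)%N -> below f j = 0.
  move=> jN; have [jk|/ltnW kj] := leqP j k.
    by rewrite -(subKn jk) down // leq_subr.
  by rewrite -(subnKC kj) up // subnKC.
have := stepG i0; rewrite !all0 ?subrr ?(ltnW i0N) // => /eqP.
by rewrite mulf_eq0 gt_eqF.
Qed.

Lemma line_decreasing f : lform f = 2 * l * lnorm f ->
  (forall k, (0 < k < N)%N -> 0 < below f k) ->
  forall i j, (i < j < N)%N -> f j < f i.
Proof.
move=> fmax G_gt0.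
have m0 i : (i < N)%N -> 0 < l - line_tr i by move=> iN; rewrite subr_gt0 line_tr_lt.
pose W := \sum_(j < N) om j.
have W0 : 0 < W.
  by rewrite /W (bigD1 (Ordinal N_gt1)) //= ltr_wpDr // sumr_ge0 // => j _; exact: ltW.
(* The product [(l - line_tr i) * f i] is strictly decreasing and has the sign of [f i], so [f]
   changes sign at most once, from positive to negative. Monotonicity is then proved separately on
   each side. *)
have psi i j : (i < j < N)%N ->
    (l - line_tr j) * f j < (l - line_tr i) * f i.
  case/andP; elim: j => // j IH ij jN.
  have H : (l - line_tr j.+1) * f j.+1 < (l - line_tr j) * f j.
    by rewrite -subr_gt0 line_potential // mulr_gt0 // G_gt0.
  have [ij'|ji] := ltnP i j; first exact: lt_trans H (IH ij' (ltnW jN)).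
  by have -> : i = j by lia.
have posL i j : (i < j < N)%N -> 0 <= f j -> 0 < f i.
  move=> ij fj; have [_ jN] := andP ij.
  rewrite -(pmulr_rgt0 _ (m0 i _)); last by lia.
  by apply: le_lt_trans (psi _ _ ij); rewrite mulr_ge0 // ltW // m0.
have negR i j : (i < j < N)%N -> f i <= 0 -> f j < 0.
  move=> ij fi; have [_ jN] := andP ij.
  rewrite -(pmulr_rlt0 _ (m0 j _)); last by lia.
  by apply: (lt_le_trans (psi _ _ ij)); rewrite pmulr_rle0 // m0 //; lia.
have left j : (j < N)%N -> 0 <= f j -> forall i, (i < j)%N -> f j < f i.
  elim: j => // j IH jN fj.
  have fj0 : 0 < f j by apply: posL fj; rewrite ltnSn.
  have fjj : f j.+1 < f j.
    rewrite -subr_lt0 -(pmulr_rlt0 _ (m0 _ jN)) line_step_right // -/W.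
    rewrite (@le_lt_trans _ _ (- W * f j)) ?mulNr ?oppr_lt0 ?mulr_gt0 //.
    rewrite gerDl pmulr_rle0 //; apply: sumr_le0 => i _.
    rewrite pmulr_rle0 // subr_le0; have [->//|ij] := eqVneq (i : nat) j.
    rewrite ltW // IH ?(ltnW jN) ?(ltW fj0) //; have := ltn_ord i; lia.
  move=> i; rewrite ltnS leq_eqVlt => /predU1P[->//|ij].
  by apply: (lt_trans fjj); apply: IH => //; [exact: ltnW | exact: ltW].
(* On the negative side the induction starts from the right end, [d] being the distance to the last
   vertex. *)
have right d i : (N - i = d.+1)%N -> f i <= 0 -> forall j, (i < j < N)%N -> f j < f i.
  elim: d i => [|d IH] i di fi j /andP[ij jN]; first by lia.
  have iN : (i.+1 < N)%N by lia.
  have fi0 : f i.+1 < 0 by apply: negR fi; rewrite ltnSn.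
  have IH' k : (i.+1 < k < N)%N -> f k < f i.+1.
    by apply: IH; [lia | exact: ltW].
  have fii : f i.+1 < f i.
    rewrite -subr_gt0 -(pmulr_rgt0 _ (m0 _ (ltnW iN))) line_step_left // -/W.
    rewrite (@lt_le_trans _ _ (- W * f i.+1)) ?mulNr ?oppr_gt0 ?pmulr_rlt0 //.
    rewrite lerDl pmulr_rge0 //; apply: sumr_ge0 => k _.
    have [ik|_] := ltnP i k; last by rewrite mul0r.
    rewrite mul1r pmulr_rge0 // subr_ge0; have [->//|ki] := eqVneq (k : nat) i.+1.
    by rewrite ltW // IH' //; have := ltn_ord k; lia.
  have [->//|ji] := eqVneq j i.+1.
  by apply: lt_trans fii; apply: IH'; lia.
move=> i j /andP[ij jN]; have [fj|fj] := leP 0 (f j); first exact: left.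
have [fi|fi] := leP 0 (f i); first exact: lt_le_trans fj fi.
by apply: (right (N - i).-1); [lia | exact: ltW | rewrite ij].
Qed.

(* Writing [G] for the partial sums of [om * f], the deficit
   [2 l |f|^2 - lform f] is [2 \sum (l - tr) om f^2 - 4 \sum G^2]; replacing
   [G] by [|G|] keeps the last sum and shrinks every [|f i|]. *)
Lemma line_maximizer_inj f : lform f = 2 * l * lnorm f ->
  (exists2 i, (i < N)%N & f i != 0) ->
  forall i j, (i < j < N)%N -> f i != f j.
Proof.
move=> fmax [i0 i0N fi0].
have m0 i : (i < N)%N -> 0 < l - line_tr i by move=> iN; rewrite subr_gt0 line_tr_lt.
pose h i := (`|below f i.+1| - `|below f i|) / om i.
have omh i : om i * h i = `|below f i.+1| - `|below f i|.
  by rewrite /h mulrC divfK // gt_eqF.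
have stepG i : om i * f i = below f i.+1 - below f i.
  by rewrite big_ord_recr /= addrAC subrr add0r.
have Gh k : below h k = `|below f k|.
  elim: k => [|k IH]; first by rewrite !big_ord0 normr0.
  by rewrite big_ord_recr /= IH omh addrC subrK.
have hf i : h i ^+ 2 <= f i ^+ 2.
  have o2 : 0 < om i ^+ 2 by rewrite exprn_gt0.
  rewrite -(ler_pM2l o2) -!exprMn omh stepG; move: (below f _) (below f _) => x y.
  have := ler_norm (x * y); rewrite normrM !sqrrB !real_normK ?num_real //; lra.
have bal := line_balance fmax.
have hN : below h N = 0 by rewrite Gh bal normr0.
have Ef := line_formE bal; have Eh := line_formE hN.
have GG : \sum_(k < N) below h k ^+ 2 = \sum_(k < N) below f k ^+ 2.
  by apply: eq_bigr => k _; rewrite Gh real_normK ?num_real.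
pose gap i := om i * (l - line_tr i) * (f i ^+ 2 - h i ^+ 2).
have gap0 (i : 'I_N) : 0 <= gap i.
  by rewrite !mulr_ge0 ?subr_ge0 ?(ltW (om_gt0 _)) ?(ltW (line_tr_lt _)).
have gapE : \sum_(i < N) gap i = l * lnorm f - \sum_(i < N) om i * line_tr i * f i ^+ 2
    - (l * lnorm h - \sum_(i < N) om i * line_tr i * h i ^+ 2).
  by rewrite !mulr_sumr -!sumrB; apply: eq_bigr => i _; rewrite /gap; ring.
have hmax0 := lmax h.
have gap_le : \sum_(i < N) gap i <= 0 by rewrite gapE; lra.
have hmax : lform h = 2 * l * lnorm h.
  have gap_ge : 0 <= \sum_(i < N) gap i by exact: sumr_ge0.
  by move: gap_ge; rewrite gapE; lra.
have hfE (i : nat) : (i < N)%N -> h i ^+ 2 = f i ^+ 2.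
  move=> iN; have /eqP : \sum_(i < N) gap i = 0.
    by apply/eqP; rewrite eq_le gap_le sumr_ge0.
  rewrite psumr_eq0 // => /allP /(_ (Ordinal iN) (mem_index_enum _)) /=.
  by rewrite mulf_eq0 gt_eqF ?mulr_gt0 ?m0 //= subr_eq0 => /eqP.
(* Being a maximizer with nonnegative partial sums, [h] has strictly positive ones; hence no
   interior partial sum of [f] vanishes. *)
have Gpos : forall k, (0 < k < N)%N -> 0 < below h k.
  apply: line_below_gt0 => // [|k _]; last by rewrite Gh.
  have h0 : h i0 ^+ 2 != 0 by rewrite hfE // sqrf_eq0.
  by exists i0 => //; rewrite sqrf_eq0 in h0.
(* Equality of squares of the increments of [G] and [|G|] forces consecutive partial sums of [f] not
   to have opposite signs. *)
have same k : (k.+1 < N)%N -> 0 <= below f k * below f k.+1.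
  move=> kN; have : (om k * h k) ^+ 2 = (om k * f k) ^+ 2.
    by rewrite [LHS]exprMn hfE ?exprMn // ltnW.
  rewrite omh stepG !sqrrB !real_normK ?num_real // => H.
  have -> : below f k * below f k.+1 = `|below f k.+1| * `|below f k| by lra.
  by rewrite mulr_ge0.
have sgn k : (0 < k < N)%N -> 0 < below f 1 * below f k.
  case/andP; elim: k => // k IH _ kN.
  have nz j : (0 < j < N)%N -> below f j != 0.
    by move=> jN; have := Gpos _ jN; rewrite Gh normr_gt0.
  case: (posnP k) => [->|k0].
    by rewrite -expr2 lt0r sqr_ge0 sqrf_eq0 nz.
  have := IH k0 (ltnW kN); have := same k kN.
  have : below f k.+1 != 0 by rewrite nz.
  have : below f k != 0 by rewrite nz // k0 ltnW.
  move: (below f 1) (below f k) (below f k.+1) => a b c b0 c0 bc ab.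
  rewrite lt0r mulf_neq0 ?andbT //=; last first.
    by apply: contraTneq ab => ->; rewrite mul0r ltxx.
  have b2 : 0 < b ^+ 2 by rewrite lt0r sqr_ge0 sqrf_eq0 b0.
  have E : b ^+ 2 * (a * c) = (a * b) * (b * c) by ring.
  rewrite -(pmulr_rge0 _ b2) E.
  by rewrite mulr_ge0 // ltW.
move=> i j ij.
have [f1|f1] := ltP 0 (below f 1).
  rewrite gt_eqF // (line_decreasing fmax) // => k kN.
  by rewrite -(pmulr_rgt0 _ f1) sgn.
have f1' : below f 1 < 0.
  rewrite lt_neqAle f1 andbT -normr_gt0 -Gh Gpos //.
pose g k := - f k.
have gmax : lform g = 2 * l * lnorm g.
  transitivity (lform f); last first.
    by rewrite fmax; congr (_ * _); apply: eq_bigr => k _; rewrite sqrrN.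
  by apply: eq_bigr => u _; apply: eq_bigr => v _; rewrite /g -opprB opprK; ring.
rewrite -eqr_opp gt_eqF // (line_decreasing gmax) // => k kN.
have -> : below g k = - below f k.
  by rewrite -sumrN; apply: eq_bigr => u _; rewrite mulrN.
by rewrite oppr_gt0 -(nmulr_rgt0 _ f1') sgn.
Qed.

End WeightedPath.

(** * Cuts along a path *)

(** Increments are nondecreasing: if the one at [k] is nonnegative the sequence climbs from [k] to
    [M], otherwise it climbs from [k] down to 0. *)
Lemma convex_le_max (R : realDomainType) (a : nat -> R) (M : nat) :
  (forall k, (k.+2 <= M)%N -> 2 * a k.+1 <= a k + a k.+2) ->
  forall k, (k <= M)%N -> a k <= Num.max (a 0%N) (a M).
Proof.
move=> cvx.
have mono j k : (j <= k)%N -> (k < M)%N -> a j.+1 - a j <= a k.+1 - a k.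
  elim: k => [|k IH]; first by rewrite leqn0 => /eqP ->.
  rewrite leq_eqVlt => /predU1P[->//|jk] kM.
  by apply: le_trans (IH jk (ltnW kM)) _; have := cvx k kM; lra.
move=> k; rewrite le_max leq_eqVlt => /predU1P[->|kM]; first by rewrite lexx orbT.
have [dk|dk] := leP 0 (a k.+1 - a k); apply/orP; [right|left].
  have H j : (k + j <= M)%N -> a k <= a (k + j)%N.
    elim: j => [|j IH]; first by rewrite addn0.
    rewrite addnS => jM; apply: le_trans (IH (ltnW jM)) _.
    by have := mono k (k + j)%N (leq_addr _ _) jM; lra.
  by rewrite -(subnKC (ltnW kM)) H // subnKC // ltnW.
have H j : (j <= k)%N -> a k <= a (k - j)%N.
  elim: j => [|j IH] jk; first by rewrite subn0.
  apply: le_trans (IH (ltnW jk)) _; rewrite -(subnSK jk).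
  have jM : (k - j.+1 < M)%N by apply: leq_ltn_trans kM; apply: leq_subr.
  by have := mono (k - j.+1)%N k (leq_subr _ _) kM; lra.
by rewrite -(subnn k) H.
Qed.

(** Since [e k] is half the second difference at [k], the value plus [e k] is the mean of the two
    neighbouring values. The extra term records how strict the inequality is. *)
Lemma convex_interior (R : realFieldType) (a e : nat -> R) (M : nat) :
  (forall k, 0 <= e k) ->
  (forall k, (k.+2 <= M)%N -> a k + a k.+2 = 2 * a k.+1 + 2 * e k.+1) ->
  forall k, (0 < k < M)%N -> a k + e k <= Num.max (a 0%N) (a M).
Proof.
move=> e0 cvx [//|k] /= kM.
have H : forall j, (j <= M)%N -> a j <= Num.max (a 0%N) (a M).
  by apply: convex_le_max => j jM; rewrite cvx // lerDl mulr_ge0.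
have := cvx k kM; have := H _ kM; have := H k (ltnW (ltnW kM)); lra.
Qed.

Section Cuts.
Variables (R : realFieldType) (V : finType).
Implicit Types (w : V -> V -> R) (s y : seq V).

Definition weight w := (forall u v, w u v = w v u) /\ (forall u v, 0 <= w u v).

Definition cut w s : R := \sum_(u | u \in s) \sum_(v | v \notin s) w u v.

(** The path [s] hangs by its first vertex from a root outside [s]: the edge above each vertex
    separates the suffix starting there. *)
Fixpoint suffix_cuts w s : R :=
  if s is _ :: s' then cut w s + suffix_cuts w s' else 0.

Definition out w s z : R := \sum_(v | v \notin s) w z v.

Lemma eq_cut w s s' : s =i s' -> cut w s = cut w s'.
Proof.
move=> ss'; apply: eq_big => [u|u _]; rewrite ?ss' //.
by apply: eq_bigl => v; rewrite ss'.
Qed.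

Lemma out_ge0 w s z : weight w -> 0 <= out w s z.
Proof. by case=> _ w0; apply: sumr_ge0. Qed.

Lemma cut_nil w : cut w [::] = 0.
Proof. by apply: big1 => u; rewrite in_nil. Qed.

Lemma cut_cons w s z : weight w -> z \notin s ->
  cut w (z :: s) = cut w s + out w (z :: s) z - \sum_(u | u \in s) w z u.
Proof.
case=> wsym _ zs; rewrite /cut (bigD1 z) ?mem_head //= addrC -/(out w (z :: s) z).
rewrite addrAC; congr (_ + _).
rewrite (eq_bigl (mem s)); last first.
  by move=> u /=; rewrite inE; case: eqP => [->|_] /=; rewrite ?(negPf zs) ?andbT.
rewrite -sumrB; apply: eq_bigr => u us; rewrite [in RHS](bigD1 z) //= wsym addrC addrK.
by apply: eq_bigl => v; rewrite inE negb_or andbC.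
Qed.

Lemma cut_double w s : weight w ->
  2 * cut w s = \sum_u \sum_v ((u \in s) != (v \in s))%:R * w u v.
Proof.
case=> wsym _; have cut1 : cut w s =
    \sum_u \sum_v ((u \in s) && (v \notin s))%:R * w u v.
  rewrite /cut big_mkcond; apply: eq_bigr => u _.
  case: (u \in s); last by rewrite big1 // => v _; rewrite mul0r.
  rewrite big_mkcond; apply: eq_bigr => v _ /=.
  by case: ifP; rewrite ?mul1r ?mul0r.
have cut2 : cut w s = \sum_u \sum_v ((u \notin s) && (v \in s))%:R * w u v.
  rewrite cut1 exchange_big; apply: eq_bigr => u _; apply: eq_bigr => v _.
  by rewrite wsym andbC.
rewrite mulr_natl mulr2n {1}cut1 cut2 -big_split; apply: eq_bigr => u _ /=.
rewrite -big_split; apply: eq_bigr => v _ /=; rewrite -mulrDl; congr (_ * _).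
by case: (u \in s); case: (v \in s) => /=; rewrite ?addr0 ?add0r.
Qed.

Lemma cut_sides w s s' : weight w -> (forall u, (u \in s) = (u \notin s')) ->
  cut w s = cut w s'.
Proof.
case=> wsym _ ss'; rewrite /cut exchange_big /=.
apply: eq_big => [u|u _]; first by rewrite ss' negbK.
by apply: eq_big => [v|v _]; rewrite ?ss' // wsym.
Qed.

(** When [z] joins [p] and when [z] joins [q], the weights between [z] and these two sides appear
    with opposite signs and cancel. *)
Lemma cut_convex w p z q : weight w -> uniq (p ++ z :: q) ->
  cut w (rcons p z) - cut w p + (cut w (z :: q) - cut w q) =
  2 * out w (p ++ z :: q) z.
Proof.
move=> ww; rewrite cat_uniq /= => /and4P[up npq zq uq].
move: npq; rewrite negb_or => /andP[zp npq].
rewrite (@eq_cut w _ (z :: p)); last by move=> u; rewrite mem_rcons.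
rewrite !cut_cons // /out.
have pq u : u \in p -> u \in q = false.
  by move=> up'; apply: contraNF npq => uq'; apply/hasP; exists u.
have -> : \sum_(v | v \notin z :: p) w z v =
    \sum_(v | v \in q) w z v + \sum_(v | v \notin p ++ z :: q) w z v.
  rewrite (bigID (mem q)) /=; congr (_ + _); apply: eq_bigl => v.
    rewrite inE negb_or; case vq: (v \in q); rewrite ?andbF ?andbT //.
    case: eqP => [vz|_] /=; first by rewrite -vz vq in zq.
    by apply/negP => /pq; rewrite vq.
  by rewrite mem_cat !inE !negb_or -andbA [RHS]andbCA.
have -> : \sum_(v | v \notin z :: q) w z v =
    \sum_(v | v \in p) w z v + \sum_(v | v \notin p ++ z :: q) w z v.
  rewrite (bigID (mem p)) /=; congr (_ + _); apply: eq_bigl => v.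
    rewrite inE negb_or; case vp: (v \in p); rewrite ?andbF ?andbT //.
    by rewrite pq //= andbT; apply/eqP => vz; rewrite -vz vp in zp.
  by rewrite mem_cat !inE !negb_or andbC.
ring.
Qed.

(* The sum of the cuts of the path [y] rooted at its [k]-th vertex. *)
Definition rooted_cuts w y k : R :=
  suffix_cuts w (rev (take k y)) + suffix_cuts w (drop k.+1 y).

Lemma rooted_cuts0 w y : rooted_cuts w y 0 = suffix_cuts w (behead y).
Proof. by rewrite /rooted_cuts take0 add0r drop1. Qed.

Lemma rooted_cuts_rev w y k : (k < size y)%N ->
  rooted_cuts w (rev y) k = rooted_cuts w y (size y - k.+1).
Proof.
move=> ky; rewrite /rooted_cuts take_rev revK drop_rev addrC; congr (_ + _).
by rewrite -subSn // subSS.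
Qed.

(** Only the edge between the old and the new root changes its far side. *)
Lemma rooted_cutsS w y k : (k.+1 < size y)%N ->
  rooted_cuts w y k.+1 - rooted_cuts w y k =
  cut w (take k.+1 y) - cut w (drop k.+1 y).
Proof.
case: y => // z0 y0; move: (z0 :: y0) => y ky.
rewrite /rooted_cuts (take_nth z0) ?(ltnW ky) // rev_rcons /= -/(rev _).
rewrite (@eq_cut w (_ :: rev _) (rcons (take k y) (nth z0 y k))); last first.
  by move=> u; rewrite mem_rcons !inE mem_rev.
rewrite (drop_nth z0 ky) /=; ring.
Qed.

Lemma rooted_cuts_convex w y k z0 : weight w -> uniq y -> (k.+2 < size y)%N ->
  rooted_cuts w y k + rooted_cuts w y k.+2 =
  2 * rooted_cuts w y k.+1 + 2 * out w y (nth z0 y k.+1).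
Proof.
move=> ww uy ky; have E1 := rooted_cutsS w ky; have E0 := rooted_cutsS w (ltnW ky).
have yE : y = take k.+1 y ++ nth z0 y k.+1 :: drop k.+2 y.
  by rewrite -drop_nth ?cat_take_drop // ltnW.
have := cut_convex ww (_ : uniq (take k.+1 y ++ nth z0 y k.+1 :: drop k.+2 y)).
rewrite -yE -drop_nth ?(ltnW ky) // -take_nth ?(ltnW ky) // => /(_ uy); lra.
Qed.

Lemma rooted_cuts_le w y k z0 : weight w -> uniq y -> (0 < k < (size y).-1)%N ->
  rooted_cuts w y k + out w y (nth z0 y k) <=
  Num.max (suffix_cuts w (behead y)) (suffix_cuts w (behead (rev y))).
Proof.
move=> ww uy ky; have y0 : (0 < size y)%N by lia.
rewrite -!rooted_cuts0 rooted_cuts_rev // subn1.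
apply: (convex_interior (e := fun j => out w y (nth z0 y j))) ky => [j|j jy].
  exact: out_ge0.
by apply: rooted_cuts_convex => //; lia.
Qed.

(* An edge between two parts of the clique is split into two halves, and each of
   them is counted by the cut of its part. *)
Definition half_cuts w s : R := (suffix_cuts w s + suffix_cuts w (behead s)) / 2.

Lemma half_cutsE w s : half_cuts w s = cut w s / 2 + suffix_cuts w (behead s).
Proof.
by case: s => [|z s]; rewrite /half_cuts /= ?cut_nil; field.
Qed.

(** The path is rooted at the middle of its [k]-th edge. This edge will be a clique edge joining two
    pendant paths, as [edge_cuts_split] shows. *)
Definition edge_cuts w y k : R := (rooted_cuts w y k.+1 + rooted_cuts w y k) / 2.

Lemma edge_cuts_split w s s' : s != [::] ->
  edge_cuts w (rev s ++ s') (size s).-1 = half_cuts w s + half_cuts w s'.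
Proof.
case: s => // z s _; set y := rev _ ++ s'.
have e1 : take (size s).+1 y = rev (z :: s) by rewrite take_size_cat ?size_rev.
have e2 : take (size s) y = rev s.
  by rewrite /y rev_cons cat_rcons take_size_cat ?size_rev.
have e3 : drop (size s).+1 y = s' by rewrite drop_size_cat ?size_rev.
have e4 : drop (size s).+2 y = behead s'.
  by rewrite -drop1 -e3 drop_drop add1n.
by rewrite /edge_cuts /rooted_cuts /half_cuts /= e1 e2 e3 e4 !revK /=; field.
Qed.

Lemma edge_cuts0 w y z0 : (1 < size y)%N ->
  edge_cuts w y 0 = half_cuts w [:: head z0 y] + half_cuts w (behead y).
Proof.
case: y => [|z [|z' y]] //= _.
by rewrite -(edge_cuts_split w (z' :: y) (isT : [:: z] != [::])).
Qed.

Lemma edge_cuts_rev w y k : (k.+1 < size y)%N ->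
  edge_cuts w (rev y) k = edge_cuts w y (size y - k.+2).
Proof.
move=> ky; rewrite /edge_cuts !rooted_cuts_rev ?(ltnW ky) // addrC.
by rewrite -subSn // subSS.
Qed.

Lemma edge_cuts_le w y k z0 : weight w -> uniq y -> (0 < k < (size y).-2)%N ->
  edge_cuts w y k + (out w y (nth z0 y k) + out w y (nth z0 y k.+1)) / 2 <=
  Num.max (edge_cuts w y 0) (edge_cuts w (rev y) 0).
Proof.
move=> ww uy ky; rewrite edge_cuts_rev ?subn2; last by lia.
pose e j := (out w y (nth z0 y j) + out w y (nth z0 y j.+1)) / 2.
apply: (convex_interior (e := e)) ky => [j|j jy].
  by rewrite divr_ge0 ?addr_ge0 ?out_ge0.
have j2 : (j.+2 < size y)%N by lia.
have j3 : (j.+3 < size y)%N by lia.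
have H0 := rooted_cuts_convex z0 ww uy j2; have H1 := rooted_cuts_convex z0 ww uy j3.
by rewrite /edge_cuts /e; lra.
Qed.

(** The two sides of every edge are now complementary and have the same cut, so moving the root
    changes nothing, for any weight. *)
Lemma edge_cuts_cover w y k : weight w -> uniq y -> (forall u, u \in y) ->
  (k.+1 < size y)%N -> edge_cuts w y k = edge_cuts w y 0.
Proof.
move=> ww uy yV ky; rewrite /edge_cuts.
suff H j : (j < size y)%N -> rooted_cuts w y j = rooted_cuts w y 0.
  by rewrite !H //; lia.
elim: j => // j IH jy; rewrite -(IH (ltnW jy)); apply/eqP.
rewrite -subr_eq0 rooted_cutsS // subr_eq0; apply/eqP/cut_sides => // u.
have := yV u; have := uy; rewrite -{1 2}(cat_take_drop j.+1 y) cat_uniq mem_cat.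
case/and3P=> _ /hasPn H _; case ud: (u \in drop _ y); last by rewrite orbF => ->.
by move=> _; apply/negbTE/H.
Qed.

End Cuts.

(** * Merging pendant paths *)

Section Straightening.
Variables (R : realFieldType) (V : finType) (X : V -> R) (C : {set V}).
Implicit Types (w : V -> V -> R) (rep : V -> V) (s : V -> seq V).
Implicit Types (F : (V -> V -> R) -> R).

Definition sqdiff (u v : V) : R := (X u - X v) ^+ 2.

Lemma weight_sqdiff : weight sqdiff.
Proof. by split=> u v; [rewrite /sqdiff -sqrrN opprB | exact: sqr_ge0]. Qed.

(** With [C] a maximum clique, this is what [kite_class_card] excludes for a top eigenvector of the
    kite. *)
Definition big_class : Prop := exists y, (#|C| <= #|[set e | X e == X y]|)%N.

(* Indicator weights of pairs of vertices turn the last alternative into an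
   inequality between distances. *)
Definition dominated F F' : Prop :=
  F sqdiff <= F' sqdiff /\
  (F sqdiff = F' sqdiff -> big_class \/ forall w, weight w -> F w <= F' w).

Lemma dominated_pointwise F F' :
  (forall w, weight w -> F w <= F' w) -> dominated F F'.
Proof. by move=> H; split=> [|_]; [exact: H weight_sqdiff | right]. Qed.

Lemma dominated_gap F F' (e : R) : 0 <= e -> F sqdiff + e <= F' sqdiff ->
  (e = 0 -> big_class) -> dominated F F'.
Proof. by move=> e0 Fe He; split=> [|E]; [lra | left; apply: He; lra]. Qed.

Lemma dominated_trans F1 F2 F3 :
  dominated F1 F2 -> dominated F2 F3 -> dominated F1 F3.
Proof.
move=> [le12 eq12] [le23 eq23]; split=> [|E]; first exact: le_trans le23.
have E12 : F1 sqdiff = F2 sqdiff by lra.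
have E23 : F2 sqdiff = F3 sqdiff by lra.
have [|H12] := eq12 E12; first by left.
have [|H23] := eq23 E23; first by left.
by right=> w ww; apply: le_trans (H12 w ww) (H23 w ww).
Qed.

Lemma big_class_out (y : seq V) (z : V) (D : {set V}) : z \in y ->
  out sqdiff y z = 0 -> (forall u, u \in D -> u \notin y) ->
  [set z] :|: D \subset [set e | X e == X z].
Proof.
move=> zy out0 Dy; apply/subsetP => u; rewrite !inE => /orP[/eqP ->//|/Dy uy].
have /allP : all (fun v => (v \notin y) ==> (sqdiff z v == 0)) (index_enum V).
  by rewrite -psumr_eq0 => [|v _]; [exact/eqP | exact: sqr_ge0].
by move=> /(_ u (mem_index_enum _)); rewrite uy /= sqrf_eq0 subr_eq0 eq_sym.
Qed.

(** The label [z] is only the place where the part is attached; once a path has been slid, the head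
    of [s z] may be another vertex. *)
Definition parts rep s : Prop :=
  forall z, uniq (s z) /\ forall u, (u \in s z) = (rep u == z).

Lemma big_two (z1 z2 : V) (P : pred V) (F F' : V -> R) : z1 != z2 -> P z1 -> P z2 ->
  (forall z, z != z1 -> z != z2 -> F z = F' z) ->
  \sum_(z | P z) F z - \sum_(z | P z) F' z = F z1 + F z2 - (F' z1 + F' z2).
Proof.
move=> z12 P1 P2 FF'; rewrite -sumrB (bigD1 z1) //= (bigD1 z2) /=; last first.
  by rewrite P2 eq_sym.
rewrite big1 => [|z /andP[/andP[_ zz1] zz2]]; last by rewrite FF' ?subrr.
ring.
Qed.

Definition path_value s w : R := \sum_(z in C) half_cuts w (s z).

Lemma sum_cut_parts rep s w : parts rep s -> (forall u, rep u \in C) ->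
  \sum_(z in C) cut w (s z) = \sum_u \sum_v (rep u != rep v)%:R * w u v.
Proof.
move=> rs repC; rewrite [RHS](partition_big rep (mem C)) //=.
apply: eq_bigr => z zC; have [_ sz] := rs z; rewrite /cut.
apply: eq_big => [u|u]; rewrite sz // => /eqP ->.
rewrite big_mkcond; apply: eq_bigr => v _; rewrite sz eq_sym.
by case: eqP; rewrite ?mul0r ?mul1r.
Qed.

(** The half cuts of all parts add up to the weight between different parts, that is, to the
    contribution of label distances all equal to 1. *)
Lemma path_valueE rep s w : parts rep s -> (forall u, rep u \in C) ->
  path_value s w = (\sum_u \sum_v (rep u != rep v)%:R * w u v) / 2 +
                   \sum_z suffix_cuts w (behead (s z)).
Proof.
move=> rs repC; rewrite -(sum_cut_parts w rs repC) mulr_suml.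
rewrite [X in _ + X](bigID (mem C)) /= [X in _ + (_ + X)]big1 ?addr0; last first.
  move=> z zC; suff -> : s z = [::] by [].
  case E : (s z) => [//|u q]; have [_ /(_ u)] := rs z.
  by rewrite E mem_head => /esym/eqP zu; move: zC; rewrite -zu repC.
by rewrite -big_split; apply: eq_bigr => z _; exact: half_cutsE.
Qed.

Section Trees.
Variable d : V -> V -> nat.
Hypothesis d_sym : forall u v, d u v = d v u.
Hypothesis d_refl : forall u, d u u = 0%N.

(* The vertices of a part hang as a path [s z] rooted at its head, and the heads
   are at the distances given by their labels. *)
Definition tree_value rep s w : R :=
  (\sum_u \sum_v (d (rep u) (rep v))%:R * w u v) / 2 +
  \sum_z suffix_cuts w (behead (s z)).

(** Moving the label [v] to [p] shortens a distance by at most 1, and only for pairs separated by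
    [s v]; the cut of [s v] pays for this, twice because pairs are ordered. *)
Lemma relabel_le rep s v p w : weight w -> parts rep s -> p != v ->
  (forall z, (d v z <= (d p z).+1)%N) ->
  \sum_u \sum_u' (d (rep u) (rep u'))%:R * w u u' <=
  \sum_u \sum_u' (d (if rep u == v then p else rep u)
                    (if rep u' == v then p else rep u'))%:R * w u u'
  + 2 * cut w (s v).
Proof.
move=> ww rs pv dvp; have [wsym w0] := ww; have [_ sv] := rs v.
have -> : 2 * cut w (s v) =
    \sum_u \sum_u' ((rep u == v) != (rep u' == v))%:R * w u u'.
  rewrite cut_double //; apply: eq_bigr => u _; apply: eq_bigr => u' _.
  by rewrite !sv.
rewrite -big_split; apply: ler_sum => u _ /=.
rewrite -big_split; apply: ler_sum => u' _ /=; rewrite -mulrDl.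
apply: ler_wpM2r => //; rewrite -natrD ler_nat.
case: (eqVneq (rep u) v) => [->|_]; case: (eqVneq (rep u') v) => [->|_] /=.
- by rewrite !d_refl.
- by rewrite addn1.
- by rewrite addn1 d_sym [d _ p]d_sym.
- by rewrite addn0.
Qed.

(** The path at [v] is hung below the head of the path at [p]. That head [r] is then the root of a
    path with two arms, and sliding the root to the better end restores a single pendant path
    labelled [p]. *)
Lemma merge_leaf rep s v p : parts rep s -> (forall c, c \in C -> rep c = c) ->
  v \notin C -> rep v = v -> rep p = p -> p != v ->
  (forall z, (d v z <= (d p z).+1)%N) ->
  let rep' u := if rep u == v then p else rep u in
  exists2 s', parts rep' s' & dominated (tree_value rep s) (tree_value rep' s').
Proof.
move=> rs repC vC repv repp pv dvp rep'.
have [up sp] := rs p; have [uv sv] := rs v.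
have : p \in s p by rewrite sp repp.
have : v \in s v by rewrite sv repv.
case svE : (s v) => [//|b B] _; case spE : (s p) => [//|r A] _.
pose y := rev A ++ r :: b :: B.
have yE u : (u \in y) = (rep u == p) || (rep u == v).
  by rewrite -sp -sv spE svE mem_cat mem_rev !inE orbCA orbA.
have uy : uniq y.
  rewrite /y -cat_rcons -rev_cons -spE cat_uniq rev_uniq up -svE uv andbT /=.
  apply/hasPn => u; rewrite mem_rev sp sv => /eqP ->; by rewrite eq_sym.
have yfE w : rooted_cuts w y (size A) =
    suffix_cuts w (behead (s p)) + suffix_cuts w (s v).
  rewrite /rooted_cuts spE svE /= take_size_cat ?size_rev // revK.
  by rewrite drop_cat size_rev ltnNge leqnSn /= subSnn drop1.
pose s' (y' : seq V) z := if z == p then y' else if z == v then [::] else s z.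
have ps' y' : uniq y' -> y' =i y -> parts rep' (s' y').
  move=> uy' y'E z; rewrite /s' /rep'; split.
    by case: ifP => // _; case: ifP => // _; have [] := rs z.
  move=> u; case: (eqVneq z p) => [->|zp].
    by rewrite y'E yE orbC; case: ifP => //; rewrite eqxx.
  case: (eqVneq z v) => [->|zv].
    rewrite in_nil; case: (eqVneq (rep u) v) => [_|/negPf -> //].
    by rewrite (negPf pv).
  have [_ ->] := rs z; case: (eqVneq (rep u) v) => [->|//].
  by rewrite [v == z]eq_sym (negPf zv) [p == z]eq_sym (negPf zp).
have value y' w : weight w -> tree_value rep s w + suffix_cuts w (behead y') <=
    tree_value rep' (s' y') w + rooted_cuts w y (size A).
  move=> ww; have := relabel_le ww rs pv dvp; rewrite -/rep' /tree_value.
  have E : \sum_z suffix_cuts w (behead (s z)) -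
      \sum_z suffix_cuts w (behead (s' y' z)) =
      suffix_cuts w A + suffix_cuts w B - suffix_cuts w (behead y').
    rewrite (@big_two p v) // => [|z zp zv]; last by rewrite /s' (negPf zp) (negPf zv).
    by rewrite /s' !eqxx eq_sym (negPf pv) spE svE /= addr0.
  rewrite yfE spE svE /=; lra.
(* With an empty first arm [y] is already rooted at its end, and the bound holds for every
   weight. *)
have [A0|A0] := posnP (size A).
  exists (s' y); first exact: ps'.
  apply: dominated_pointwise => w ww; have := value y w ww.
  by rewrite A0 rooted_cuts0; lra.
have kint : (0 < size A < (size y).-1)%N.
  by rewrite A0 /y size_cat size_rev /= addnS /= -addSnnS leq_addr.
have rE : nth r y (size A) = r by rewrite /y nth_cat size_rev ltnn subnn.
have slide := rooted_cuts_le r weight_sqdiff uy kint; rewrite rE in slide.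
have out0 := out_ge0 y r weight_sqdiff.
(* Without gain, all vertices outside [y] share the value of [r]. They include [C] minus possibly
   [p], and [r] itself restores the count. *)
have big : out sqdiff y r = 0 -> big_class.
  move=> o0; exists r.
  have ry : r \in y by rewrite mem_cat mem_head orbT.
  have CpE : forall u, u \in C :\ p -> u \notin y.
    move=> u; rewrite !inE yE => /andP[u_p uC]; rewrite repC // (negPf u_p).
    by apply: contraNneq vC => <-.
  apply: leq_trans (subset_leq_card (big_class_out ry o0 CpE)).
  rewrite cardsU1 (contraL (CpE r)) ?ry // add1n.
  by rewrite (cardsD1 p C); case: (p \in C).
have [y' [uy' y'E slide']] : exists y', [/\ uniq y', y' =i y &
    rooted_cuts sqdiff y (size A) + out sqdiff y r <=
    suffix_cuts sqdiff (behead y')].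
  move: slide; rewrite le_max => /orP[] H; first by exists y.
  by exists (rev y); rewrite rev_uniq; split=> // u; rewrite mem_rev.
exists (s' y'); first exact: ps'.
apply: dominated_gap out0 _ big.
by have := value y' sqdiff weight_sqdiff; lra.
Qed.

Variables (par : V -> V) (rank : V -> nat).
Hypothesis par_rank : forall v, v \notin C -> (rank (par v) < rank v)%N.
Hypothesis par_dist : forall v z, v \notin C -> (d v z <= (d (par v) z).+1)%N.

(** Induction on the number of labels outside [C]. The chosen label has maximal rank, so it is the
    parent of no other label and the labels stay closed under [par] after its removal. *)
Lemma straighten_trees rep s : parts rep s -> (forall c, c \in C -> rep c = c) ->
  (forall u, rep (rep u) = rep u) ->
  (forall v, v \notin C -> rep v = v -> rep (par v) = par v) ->
  exists rep' s', [/\ parts rep' s', forall c, c \in C -> rep' c = c,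
    forall u, rep' u \in C & dominated (tree_value rep s) (tree_value rep' s')].
Proof.
have [n] := ubnP #|[set z | (z \notin C) && (rep z == z)]|.
elim: n => // n IH in rep s * => nle rs repC idem clos.
have [/existsP[v0 v0P]|] := boolP [exists z, (z \notin C) && (rep z == z)]; last first.
  rewrite negb_exists => /forallP H; exists rep, s; split=> //.
    by move=> u; have := H (rep u); rewrite idem eqxx andbT negbK.
  by apply: dominated_pointwise.
case: (@arg_maxnP _ v0 (fun z => (z \notin C) && (rep z == z)) rank v0P).
move=> v /andP[vC /eqP repv] vmax {v0 v0P}.
have rank_le z : z \notin C -> rep z = z -> (rank z <= rank v)%N.
  by move=> zC rz; apply: vmax; rewrite zC rz eqxx.
have pv : par v != v by apply: contraTneq (par_rank vC) => ->; rewrite ltnn.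
have repp := clos v vC repv.
have [s' ps' dom] := merge_leaf rs repC vC repv repp pv (fun z => par_dist z vC).
set rep' := fun u => _ in ps' dom.
have lt' : (#|[set z | (z \notin C) && (rep' z == z)]| < n)%N.
  rewrite ltnS in nle; apply: leq_trans nle; apply/proper_card/properP; split.
    apply/subsetP => z; rewrite !inE /rep' => /andP[-> /=].
    case: (eqVneq (rep z) v) => // rzv /eqP pz.
    by move: repp pv; rewrite pz rzv => ->; rewrite eqxx.
  exists v; first by rewrite inE vC repv eqxx.
  by rewrite inE /rep' repv eqxx negb_and pv orbT.
have repC' c : c \in C -> rep' c = c.
  by move=> cC; rewrite /rep' repC //; case: eqP => // cv; rewrite -cv cC in vC.
have idem' u : rep' (rep' u) = rep' u.
  rewrite /rep'; case: (eqVneq (rep u) v) => [_|ruv]; first by rewrite repp (negPf pv).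
  by rewrite idem (negPf ruv).
have clos' z : z \notin C -> rep' z = z -> rep' (par z) = par z.
  move=> zC; rewrite /rep'; case: (eqVneq (rep z) v) => [rzv pz|rzv rz].
    by move: repp pv; rewrite pz rzv => ->; rewrite eqxx.
  rewrite (clos z zC rz); case: eqP => // pzv.
  by have := par_rank zC; rewrite pzv ltnNge rank_le.
have [rep2 [s2 [p2 repC2 rep2C dom2]]] := IH rep' s' lt' ps' repC' idem' clos'.
exists rep2, s2; split=> //; exact: dominated_trans dom dom2.
Qed.

Lemma tree_value_path rep s w : weight w -> parts rep s ->
  (forall u, rep u \in C) -> {in C &, forall c c', (d c c' <= 1)%N} ->
  tree_value rep s w <= path_value s w.
Proof.
move=> [_ w0] rs repC dC; rewrite (path_valueE w rs repC) lerD2r.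
rewrite ler_pM2r ?invr_gt0 ?ltr0n //; apply: ler_sum => u _; apply: ler_sum => v _.
apply: ler_wpM2r => //; rewrite ler_nat; case: eqP => [->|_]; first by rewrite d_refl.
exact: dC.
Qed.

End Trees.

(** The two pendant paths and the clique edge between them form one path [y]. Sliding that edge to
    the better end of [y] leaves a single vertex at [z1] and everything else at [z2]. *)
Lemma merge_paths rep s z1 z2 : parts rep s -> (forall u, rep u \in C) ->
  (forall z, z \in C -> s z != [::]) -> z1 \in C -> z2 \in C -> z1 != z2 ->
  (1 < size (s z1))%N -> (1 < size (s z2))%N ->
  exists rep' s', [/\ parts rep' s', forall u, rep' u \in C,
    forall z, z \in C -> s' z != [::],
    dominated (path_value s) (path_value s') &
    size (s' z1) = 1%N /\ forall z, z != z1 -> z != z2 -> s' z = s z].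
Proof.
move=> rs repC sC z1C z2C z12 sz1 sz2.
have [u1 s1] := rs z1; have [u2 s2] := rs z2.
pose y := rev (s z1) ++ s z2.
have yE u : (u \in y) = (rep u == z1) || (rep u == z2).
  by rewrite mem_cat mem_rev s1 s2.
have uy : uniq y.
  rewrite cat_uniq rev_uniq u1 u2 andbT /=; apply/hasPn => u.
  by rewrite mem_rev s1 s2 => /eqP ->; rewrite eq_sym.
have szy : size y = (size (s z1) + size (s z2))%N by rewrite size_cat size_rev.
have y_gt1 : (1 < size y)%N by rewrite szy ltn_addl // ltnW.
pose rep' (y' : seq V) u :=
  if u \in y then (if u == head z1 y' then z1 else z2) else rep u.
pose s' (y' : seq V) z :=
  if z == z1 then [:: head z1 y'] else if z == z2 then behead y' else s z.
have ps' y' : uniq y' -> y' =i y -> parts (rep' y') (s' y').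
  move=> uy' y'E z; have y'0 : y' != [::].
    apply: contraTneq (_ : head z1 y \in y) => [y'0|]; first by rewrite -y'E y'0.
    by case: (y) szy => [|a q] /=; [lia | rewrite mem_head].
  case: y' y'0 uy' y'E => // a q _ /= /andP[aq uq] y'E.
  rewrite /s' /rep' /=; split.
    by case: ifP => // _; case: ifP => // _; have [] := rs z.
  move=> u; rewrite -y'E inE; case: (eqVneq z z1) => [->|zz1].
    rewrite inE; case: (eqVneq u a) => [_|ua] /=; first by rewrite eqxx.
    case: ifP => uq'; first by rewrite eq_sym (negPf z12).
    have := yE u; rewrite -y'E inE (negPf ua) uq' /=.
    by move/esym/negbT; rewrite negb_or => /andP[/negPf ->].
  case: (eqVneq z z2) => [->|zz2].
    case: (eqVneq u a) => [->|ua] /=; first by rewrite (negPf aq) (negPf z12).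
    case: ifP => uq'; first by rewrite eqxx.
    have := yE u; rewrite -y'E inE (negPf ua) uq' /=.
    by move/esym/negbT; rewrite negb_or => /andP[_ /negPf ->].
  have z1z : (z1 == z) = false by rewrite eq_sym (negPf zz1).
  have z2z : (z2 == z) = false by rewrite eq_sym (negPf zz2).
  have [_ ->] := rs z; case: ifP => // uy''.
  have := yE u; rewrite -y'E inE uy'' => /esym/orP[] /eqP ->.
    by case: ifP; rewrite ?z1z ?z2z.
  by case: ifP; rewrite ?z1z ?z2z.
have valid y' : uniq y' -> y' =i y -> dominated (path_value s) (path_value (s' y')) ->
    exists rep' s', [/\ parts rep' s', forall u, rep' u \in C,
    forall z, z \in C -> s' z != [::],
    dominated (path_value s) (path_value s') &
    size (s' z1) = 1%N /\ forall z, z != z1 -> z != z2 -> s' z = s z].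
  move=> uy' y'E dom; exists (rep' y'), (s' y'); split=> //.
  - exact: ps'.
  - by move=> u; rewrite /rep'; case: ifP => // _; case: ifP.
  - move=> z zC; rewrite /s'; case: ifP => // _; case: ifP => // [_|_]; last exact: sC.
    have := perm_size (uniq_perm uy' uy y'E); rewrite szy.
    by case: (y') => [|a [|b q]] //=; lia.
  - split=> [|z /negPf zz1 /negPf zz2]; first by rewrite /s' eqxx.
    by rewrite /s' zz1 zz2.
have value y' w : (1 < size y')%N ->
    path_value s w - path_value (s' y') w =
    edge_cuts w y (size (s z1)).-1 - edge_cuts w y' 0.
  move=> y'1; rewrite (@big_two z1 z2) // => [|z zz1 zz2]; last first.
    by rewrite /s' (negPf zz1) (negPf zz2).
  rewrite edge_cuts_split ?sC // (edge_cuts0 w z1) //.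
  by rewrite /s' !eqxx eq_sym (negPf z12).
have [/forallP yV|/forallPn[e0 e0y]] := boolP [forall u, u \in y].
  apply: (valid y) => //; apply: dominated_pointwise => w ww.
  have ky : ((size (s z1)).-1.+1 < size y)%N by lia.
  by rewrite -subr_le0 value // (edge_cuts_cover ww) ?subrr.
have kint : (0 < (size (s z1)).-1 < (size y).-2)%N by lia.
have slide := edge_cuts_le z1 weight_sqdiff uy kint.
set k := (size (s z1)).-1 in slide kint value.
have ky : (k.+1 < size y)%N by lia.
set a := nth z1 y k in slide; set b := nth z1 y k.+1 in slide.
have ay : a \in y by rewrite mem_nth // ltnW.
have by_ : b \in y by rewrite mem_nth.
have outa := out_ge0 y a weight_sqdiff; have outb := out_ge0 y b weight_sqdiff.
have big : (out sqdiff y a + out sqdiff y b) / 2 = 0 -> big_class.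
  move=> o0; have oa : out sqdiff y a = 0 by lra.
  have ob : out sqdiff y b = 0 by lra.
  pose E := [set u | u \notin y].
  have Ey u : u \in E -> u \notin y by rewrite inE.
  have cla := big_class_out ay oa Ey; have clb := big_class_out by_ ob Ey.
  have e0E : e0 \in E by rewrite inE.
  have ab : X a = X b.
    have := subsetP cla e0; have := subsetP clb e0.
    by rewrite !inE e0y !orbT => /(_ isT)/eqP <- /(_ isT)/eqP ->.
  exists a; have sub : [set a; b] :|: E \subset [set e | X e == X a].
    rewrite -setUA subUset; apply/andP; split; last by rewrite ab.
    exact: subset_trans (subsetUl _ _) cla.
  apply: leq_trans (subset_leq_card sub).
  have dis : [set a; b] :&: E = set0.
    apply/setP => u; rewrite !inE; case: eqP => [->|_]; first by rewrite ay.
    by case: eqP => [->|_] //=; rewrite by_.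
  have nab : a != b by rewrite nth_uniq // ?(ltnW ky) // neq_ltn ltnSn.
  (* Each of the remaining clique labels has a nonempty part, which lies outside [y]; together with
     [a] and [b] this gives [#|C|] vertices of equal value. *)
  have : (#|C :\ z1 :\ z2| <= #|E|)%N.
    apply: leq_trans (leq_imset_card rep E); apply: subset_leq_card.
    apply/subsetP => z; rewrite !inE => /and3P[zz2 zz1 zC].
    have := sC z zC; case sz: (s z) => [//|u q] _.
    have [_ /(_ u)] := rs z; rewrite sz mem_head => /esym/eqP rz.
    by apply/imsetP; exists u => //; rewrite inE yE rz negb_or zz1 zz2.
  have -> : #|C| = #|C :\ z1 :\ z2|.+2.
    rewrite (cardsD1 z1 C) z1C (cardsD1 z2 (C :\ z1)) in_setD1 z2C.
    by rewrite eq_sym z12.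
  by rewrite cardsU dis cards0 subn0 cards2 nab.
have e_ge0 : 0 <= (out sqdiff y a + out sqdiff y b) / 2 by rewrite divr_ge0 ?addr_ge0.
have fin y' : (1 < size y')%N ->
    edge_cuts sqdiff y k + (out sqdiff y a + out sqdiff y b) / 2 <=
      edge_cuts sqdiff y' 0 ->
    dominated (path_value s) (path_value (s' y')).
  by move=> y'1 H; apply: dominated_gap e_ge0 _ big; have := value y' sqdiff y'1; lra.
move: slide; rewrite le_max => /orP[] H.
  by apply: (valid y) => //; apply: fin.
apply: (valid (rev y)); rewrite ?rev_uniq //; first by move=> u; rewrite mem_rev.
by apply: fin; rewrite ?size_rev.
Qed.

(** Each merge leaves one part fewer with more than one vertex, until at most one is left. *)
Lemma straighten_paths rep s : (0 < #|C|)%N -> parts rep s ->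
  (forall u, rep u \in C) -> (forall z, z \in C -> s z != [::]) ->
  exists rep' s' z0, [/\ parts rep' s', forall u, rep' u \in C, z0 \in C,
    forall z, z \in C -> s' z != [::] /\ (z != z0 -> size (s' z) = 1%N) &
    dominated (path_value s) (path_value s')].
Proof.
move=> C0; have [n] := ubnP #|[set z in C | (1 < size (s z))%N]|.
elim: n => // n IH in rep s * => nle rs repC sC.
have [c0 c0C] : exists c0, c0 \in C by apply/set0Pn; rewrite -card_gt0.
have size1 z : z \in C -> ~~ (1 < size (s z))%N -> size (s z) = 1%N.
  by move=> /sC; case: (s z) => [|a [|b q]].
have stop z0 : z0 \in C -> (forall z, z \in C -> z != z0 -> ~~ (1 < size (s z))%N) ->
  exists rep' s' z0, [/\ parts rep' s', forall u, rep' u \in C, z0 \in C,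
    forall z, z \in C -> s' z != [::] /\ (z != z0 -> size (s' z) = 1%N) &
    dominated (path_value s) (path_value s')].
  move=> z0C H; exists rep, s, z0; split=> //.
    by move=> z zC; split=> [|zz0]; [exact: sC | apply: size1; last exact: H].
  exact: dominated_pointwise.
have [/exists_inP[z1 z1C sz1]|] := boolP [exists z in C, (1 < size (s z))%N]; last first.
  by rewrite negb_exists_in => /forall_inP H; apply: (stop c0) => // z zC _; exact: H.
have [/existsP[z2 /and3P[z2C z21 sz2]]|] :=
    boolP [exists z, [&& z \in C, z != z1 & (1 < size (s z))%N]]; last first.
  rewrite negb_exists => /forallP H; apply: (stop z1) => // z zC zz1.
  by have := H z; rewrite zC zz1.
have z12 : z1 != z2 by rewrite eq_sym.
have [rep' [s' [ps' repC' sC' dom [sz1' same]]]] :=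
  merge_paths rs repC sC z1C z2C z12 sz1 sz2.
have lt' : (#|[set z in C | (1 < size (s' z))%N]| < n)%N.
  rewrite ltnS in nle; apply: leq_trans nle; apply/proper_card/properP; split.
    apply/subsetP => z; rewrite !inE => /andP[-> /=].
    case: (eqVneq z z1) => [->|zz1]; first by rewrite sz1'.
    by case: (eqVneq z z2) => [->|zz2]; rewrite ?sz2 // same.
  by exists z1; rewrite !inE z1C ?sz1 // sz1'.
have [rep2 [s2 [z0 [p2 rep2C z0C s2C dom2]]]] := IH rep' s' lt' ps' repC' sC'.
exists rep2, s2, z0; split=> //; exact: dominated_trans dom dom2.
Qed.

End Straightening.

(** * Graph distance and the metric of the kite *)

Section Dist.
Local Open Scope nat_scope.

Lemma dist_refl (G : sgraph) (u : G) : dist u u = 0.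
Proof. by apply/eqP; rewrite -leqn0; apply: (@dist_le G u [::]). Qed.

Lemma dist_edge (G : sgraph) (u v z : G) : connected_graph G -> sedge u v ->
  dist u z <= (dist v z).+1.
Proof.
move=> [_ conn] uv; have [p [vp <- <-]] := dist_walk (conn v z).
by apply: (@dist_le G u (v :: p)); rewrite /= uv.
Qed.

Lemma dist_edge1 (G : sgraph) (u v : G) : sedge u v -> dist u v <= 1.
Proof. by move=> uv; apply: (@dist_le G u [:: v]); rewrite /= uv. Qed.

Lemma sedgeE (G : sgraph) (u v : G) : connected_graph G ->
  sedge u v = (u != v) && (dist u v <= 1).
Proof.
move=> [_ conn]; apply/idP/andP => [uv|[uv]].
  split; last exact: dist_edge1.
  by apply: contraTneq uv => ->; rewrite sedge_irr.
have [[|a [|b p]] [//= up lp <-]] := dist_walk (conn u v); last by [].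
  by rewrite lp eqxx in uv.
by rewrite -lp /=; case/andP: up.
Qed.

(** Descending neighbours yield a walk of length at most [D], and the Lipschitz bound along a
    shortest walk gives the converse. This serves for the kite and for isomorphic graphs. *)
Lemma dist_unique (G : sgraph) (D : G -> G -> nat) :
  (forall u, D u u = 0) ->
  (forall u v z, sedge u v -> D u z <= (D v z).+1) ->
  (forall u z, u != z -> exists2 v, sedge u v & D v z < D u z) ->
  (forall u z, connect (@sedge G) u z) /\ forall u z, dist u z = D u z.
Proof.
move=> D0 lip desc.
have walk u z : exists p, [/\ path (@sedge G) u p, last u p = z & size p <= D u z].
  have [n] := ubnP (D u z); elim: n u => // n IH u nD.
  have [->|/desc[v uv vD]] := eqVneq u z; first by exists [::].
  have [|p [vp lp sp]] := IH v; first by lia.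
  by exists (v :: p); rewrite /= uv; split=> //; lia.
have conn u z : connect (@sedge G) u z.
  by have [p [up <- _]] := walk u z; apply/connectP; exists p.
split=> // u z; apply/eqP; rewrite eqn_leq; apply/andP; split.
  by have [p [up <- sp]] := walk u z; apply: leq_trans (dist_le up) sp.
have [p [up <- <-]] := dist_walk (conn u z).
elim: p u up => [|a p IH] u /=; first by rewrite D0.
by case/andP=> ua /IH; have := lip _ _ (last a p) ua; lia.
Qed.

Section Kite.
Variables (k m : nat).
Hypothesis k0 : 0 < k.
Notation K := (kite k m).

(** The tail stands above the clique vertex 0: a distance is the difference of heights, plus one
    clique edge when the feet differ. *)
Definition kite_height (a : 'I_k + 'I_m) : nat := if a is inr j then j.+1 else 0.
Definition kite_foot (a : 'I_k + 'I_m) : nat := if a is inl i then i : nat else 0.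
Definition kite_dist (a b : 'I_k + 'I_m) : nat :=
  natdist (kite_height a) (kite_height b) + (kite_foot a != kite_foot b).

Lemma kite_distP :
  (forall a b : K, connect (@sedge K) a b) /\ forall a b : K, dist a b = kite_dist a b.
Proof.
apply: dist_unique.
- by move=> a; rewrite /kite_dist /natdist eqxx; lia.
- move=> [i|i] [j|j] [z|z] /=; rewrite /kite_edge /kite_dist /natdist -?val_eqE /=; lia.
- move=> [i|i] [j|j] ab; rewrite /kite_dist /=.
  + exists (inl j); first by apply: contraNneq ab => /= ->.
    have ij : (i : nat) != j by apply: contraNneq ab => /val_inj ->.
    by rewrite eqxx ij /natdist.
  + have [i0|i0] := eqVneq (i : nat) 0.
      have m0 : 0 < m := leq_ltn_trans (leq0n _) (ltn_ord j).
      by exists (inr (Ordinal m0)); rewrite /= ?i0 // /natdist /=; lia.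
    exists (inl (Ordinal k0)); first by rewrite /= -val_eqE.
    rewrite /natdist /=; lia.
  + case: i ab => [[|i] im] _ /=.
      by exists (inl (Ordinal k0)); rewrite //= /natdist /=; lia.
    by exists (inr (Ordinal (ltnW im))); rewrite /= ?eqxx ?orbT // /natdist /=; lia.
  + have ij : (i : nat) != j by apply: contraNneq ab => /val_inj ->.
    have [lt|ge] := ltnP i j.
      have im : i.+1 < m := leq_ltn_trans lt (ltn_ord j).
      by exists (inr (Ordinal im)); rewrite /= ?eqxx // /natdist /=; lia.
    case: i ij ge ab => [[|i] im] /= ij ge _; first by lia.
    by exists (inr (Ordinal (ltnW im))); rewrite /= ?eqxx ?orbT // /natdist /=; lia.
Qed.

Lemma kite_connected : connected_graph K.
Proof. by split; [rewrite card_sum !card_ord addn_gt0 k0 | case: kite_distP]. Qed.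

Lemma dist_kite (a b : K) : dist a b = kite_dist a b.
Proof. by case: kite_distP. Qed.

End Kite.
End Dist.

(** * From clique-attached paths to the kite *)

Section Flatten.
Variables (R : realFieldType) (V : finType).

(** The number of suffixes of [P] separating [u] from [v] is the difference of their depths,
    vertices off [P] having depth 0. *)
Lemma suffix_cuts_path (w : V -> V -> R) (P : seq V) : weight w -> uniq P ->
  let h u := if u \in P then (index u P).+1 else 0%N in
  suffix_cuts w P = (\sum_u \sum_v (natdist (h u) (h v))%:R * w u v) / 2.
Proof.
move=> ww uP h; suff H : 2 * suffix_cuts w P =
    \sum_u \sum_v (natdist (h u) (h v))%:R * w u v.
  by rewrite -H mulrC mulKf // pnatr_eq0.
elim: P uP @h => [|p P IH] uP h.
  rewrite /= mulr0 big1 // => u _; rewrite big1 // => v _.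
  by rewrite /h !in_nil mul0r.
have /andP[pP {}uP] := uP; rewrite [suffix_cuts _ _]/= mulrDr IH // cut_double //.
rewrite -big_split; apply: eq_bigr => u _ /=.
rewrite -big_split; apply: eq_bigr => v _ /=; rewrite -mulrDl -natrD; congr (_%:R * _).
have hE x : h x = ((x \in p :: P) + if x \in P then (index x P).+1 else 0)%N.
  rewrite /h inE /= eq_sym; case: (eqVneq p x) => [<-|_] //=; first by rewrite (negPf pP).
  by case: ifP.
rewrite !hE /natdist !inE; case: ifP; case: ifP; rewrite ?orbT ?orbF; lia.
Qed.

Variable C : {set V}.

Lemma card_parts (rep : V -> V) (s : V -> seq V) : parts rep s ->
  (forall u, rep u \in C) -> #|V| = (\sum_(z in C) size (s z))%N.
Proof.
move=> rs repC; rewrite -sum1_card (partition_big rep (mem C)) //=.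
apply: eq_bigr => z zC; have [uz sz] := rs z.
by rewrite -(card_uniqP uz) -sum1_card; apply: eq_bigl => u; rewrite sz.
Qed.

Lemma paths_to_kite (rep : V -> V) (s : V -> seq V) (z0 : V) : parts rep s ->
  (forall u, rep u \in C) -> z0 \in C ->
  (forall z, z \in C -> s z != [::] /\ (z != z0 -> size (s z) = 1%N)) ->
  exists2 f : V -> kite #|C| (#|V| - #|C|), bijective f &
    forall w : V -> V -> R, weight w -> path_value C s w =
      (\sum_u \sum_v (dist (f u) (f v))%:R * w u v) / 2.
Proof.
move=> rs repC z0C sP; have [s0 _] := sP z0 z0C.
have s1 z : z \in C -> z != z0 -> size (s z) = 1%N by case/sP.
have C0 : (0 < #|C|)%N by apply/card_gt0P; exists z0.
pose P := behead (s z0); pose m := (#|V| - #|C|)%N.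
have [uz0 sz0] := rs z0.
case sz0E : (s z0) s0 => [//|r q] _; have PE : P = q by rewrite /P sz0E.
have rq : uniq (r :: q) by rewrite -sz0E.
have [rq' uq] := andP rq.
have mE : size q = m.
  rewrite /m (card_parts rs repC) (bigD1 z0) //= sz0E /=.
  rewrite (eq_bigr (fun=> 1%N)) => [|z /andP[zC zz0]]; last exact: s1.
  rewrite sum1_card (cardsD1 z0 C) z0C.
  have -> : #|[pred z | (z \in C) && (z != z0)]| = #|C :\ z0|.
    by apply: eq_card => z; rewrite !inE andbC.
  lia.
(* Listing [z0] first gives it index 0, the clique vertex that carries the tail. *)
pose L := z0 :: enum (C :\ z0).
have LC z : (z \in L) = (z \in C).
  by rewrite inE mem_enum !inE; case: eqP => [->|].
have sizeL : size L = #|C| by rewrite /= -cardE (cardsD1 z0 C) z0C.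
(* As [size q = m], [insub] succeeds exactly on [q], which becomes the tail. The default of [insubd]
   is never reached, every label being in [L]. *)
pose f u : kite #|C| m := if insub (index u q) is Some j then inr j
  else inl (insubd (Ordinal C0) (index (rep u) L)).
pose h u := if u \in q then (index u q).+1 else 0%N.
have heightE u : kite_height (f u) = h u.
  rewrite /f /h -index_mem mE.
  by case: insubP => [j /= -> ->|/negPf ->].
have footE u : kite_foot (f u) = index (rep u) L.
  have lt : (index (rep u) L < #|C|)%N by rewrite -sizeL index_mem LC repC.
  rewrite /f; case: insubP => [j jP _|_]; last by rewrite /kite_foot val_insubd lt.
  have uq' : u \in q by rewrite -index_mem mE.
  have : u \in s z0 by rewrite sz0E inE uq' orbT.
  by rewrite sz0 => /eqP ->; rewrite /= eqxx.
have idx_inj u v : (index (rep u) L != index (rep v) L) = (rep u != rep v).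
  congr (~~ _); apply/eqP/eqP => [E|->//].
  by rewrite -(nth_index z0 (_ : rep u \in L)) ?E ?nth_index ?LC.
have inj_f : injective f.
  move=> u v fuv; have hh : h u = h v by rewrite -!heightE fuv.
  have /eqP : index (rep u) L = index (rep v) L by rewrite -!footE fuv.
  rewrite -[_ == _]negbK idx_inj negbK => /eqP ruv.
  move: hh; rewrite /h; case: ifP => uq'; case: ifP => vq' //.
    by move=> [E]; rewrite -(nth_index r uq') E nth_index.
  move=> _; have us : u \in s (rep u) by have [_ ->] := rs (rep u).
  have vs : v \in s (rep u) by have [_ ->] := rs (rep u); rewrite ruv.
  have [E|ne] := eqVneq (rep u) z0.
    by move: us vs; rewrite E sz0E !inE uq' vq' !orbF => /eqP -> /eqP ->.
  have := s1 _ (repC u) ne; case: (s (rep u)) us vs => [|a [|b t]] //=.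
  by rewrite !inE => /eqP -> /eqP ->.
exists f.
  apply: inj_card_bij inj_f _; rewrite card_sum !card_ord.
  by rewrite /m subnKC // max_card.
move=> w ww; rewrite (path_valueE w rs repC) [X in _ + X](bigD1 z0) //= sz0E /=.
rewrite [X in _ + (_ + X)]big1 ?addr0; last first.
  move=> z zz0; have [zC|zC] := boolP (z \in C).
    by have := s1 z zC zz0; case: (s z) => [|a [|b t]].
  case E : (s z) => [//|u t]; have [_ /(_ u)] := rs z.
  by rewrite E mem_head => /esym/eqP zu; move: zC; rewrite -zu repC.
rewrite (suffix_cuts_path ww uq) -mulrDl -big_split; congr (_ / _).
apply: eq_bigr => u _ /=; rewrite -big_split; apply: eq_bigr => v _ /=.
rewrite -mulrDl -natrD dist_kite // /kite_dist !heightE !footE idx_inj addnC.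
by congr (_%:R * _).
Qed.

End Flatten.

(** * Straightening a connected graph *)

Section Main.
Variables (R : realType) (G : sgraph).

(** Every vertex starts as its own part, and the parent of a vertex outside [C] is a neighbour
    closer to a fixed [c0] in [C]. The trees are straightened, then the resulting paths merged into
    one. *)
Lemma straighten_graph (X : G -> R) (C : {set G}) : connected_graph G ->
  clique C -> (0 < #|C|)%N ->
  exists2 f : G -> kite #|C| (#|G| - #|C|), bijective f &
    dominated X C (fun w => (\sum_u \sum_v (dist u v)%:R * w u v) / 2)
                  (fun w => (\sum_u \sum_v (dist (f u) (f v))%:R * w u v) / 2).
Proof.
move=> conn clC C0; have [c0 c0C] := card_gt0P C0.
have up v : v \notin C -> exists p, sedge v p && (dist c0 p < dist c0 v)%N.
  move=> vC; have [p [cp lp <-]] := dist_walk (proj2 conn c0 v).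
  case/lastP: p cp lp => [_ /= cv|p x]; first by rewrite -cv c0C in vC.
  rewrite rcons_path last_rcons => /andP[cp px] xv; exists (last c0 p).
  by rewrite sedge_sym -xv px size_rcons ltnS dist_le.
pose par v := odflt v [pick p | sedge v p && (dist c0 p < dist c0 v)%N].
have parP v : v \notin C -> sedge v (par v) && (dist c0 (par v) < dist c0 v)%N.
  move=> /up[p pP]; rewrite /par; case: pickP => //= /(_ p); by rewrite pP.
pose s0 (z : G) := [:: z].
have ps0 : parts id s0 by move=> z; split=> // u; rewrite inE.
have [rep1 [s1 [p1 repC1 rep1C dom1]]] :=
  @straighten_trees R G X C (@dist G) (@dist_sym G) (@dist_refl G) par (dist c0)
    (fun v vC => proj2 (andP (parP v vC)))
    (fun v z vC => dist_edge z conn (proj1 (andP (parP v vC))))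
    id s0 ps0 (fun _ _ => erefl) (fun _ => erefl) (fun _ _ _ => erefl).
have C1 : {in C &, forall c c', (dist c c' <= 1)%N}.
  move=> c c' cC c'C; have [->|ne] := eqVneq c c'; first by rewrite dist_refl.
  apply: dist_edge1.
  by move: clC => /forall_inP/(_ c cC)/forall_inP/(_ c' c'C)/implyP/(_ ne).
have s1C z : z \in C -> s1 z != [::].
  move=> zC; have [_ /(_ z)] := p1 z; rewrite repC1 // eqxx.
  by case: (s1 z).
have [rep2 [s2 [z0 [p2 rep2C z0C s2C dom2]]]] := straighten_paths X C0 p1 rep1C s1C.
have [f bij_f fE] := @paths_to_kite R _ C rep2 s2 z0 p2 rep2C z0C s2C.
exists f => //; apply: dominated_trans (dominated_trans dom1 _); last first.
  apply: dominated_trans (dominated_trans dom2 _).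
    apply: dominated_pointwise => w ww.
    exact: (tree_value_path (@dist_refl G) ww p1 rep1C C1).
  by apply: dominated_pointwise => w ww; rewrite fE.
apply: dominated_pointwise => w ww; rewrite /tree_value /= [X in _ + X]big1 ?addr0 //.
Qed.
End Main.

(** * The kite *)

Local Notation dform := (lap_form (fun u v => (dist u v)%:R)).

Section Transfer.
Variables (R : realType) (G H : sgraph) (f : G -> H) (g : H -> G).
Hypotheses (fK : cancel f g) (gK : cancel g f).

Lemma lap_form_transfer (X : G -> R) :
  lap_form (fun u v => (dist (f u) (f v))%:R) X = dform (X \o g).
Proof.
have fbij : {on xpredT, bijective f} by apply: onW_bij; exists g.
rewrite /lap_form [RHS](reindex f) //=; apply: eq_bigr => u _.
by rewrite [RHS](reindex f) //=; apply: eq_bigr => v _; rewrite !fK.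
Qed.

Lemma norm_transfer (X : G -> R) : \sum_a (X \o g) a ^+ 2 = \sum_u X u ^+ 2.
Proof.
have fbij : {on xpredT, bijective f} by apply: onW_bij; exists g.
by rewrite [LHS](reindex f) //=; apply: eq_bigr => u _; rewrite fK.
Qed.

End Transfer.

Lemma isomorphic_dist (G H : sgraph) (f : G -> H) : bijective f ->
  {mono f : x y / sedge x y} -> connected_graph H ->
  forall u v, dist (f u) (f v) = dist u v.
Proof.
move=> [g fK gK] fmono connH u v.
have D0 x : dist (f x) (f x) = 0%N by exact: dist_refl.
have lip x y z : sedge x y -> (dist (f x) (f z) <= (dist (f y) (f z)).+1)%N.
  by move=> xy; apply: dist_edge; rewrite ?fmono.
have desc x z : x != z ->
    exists2 y, sedge x y & (dist (f y) (f z) < dist (f x) (f z))%N.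
  move=> xz; have [p [xp lp sp]] := dist_walk (proj2 connH (f x) (f z)).
  case: p xp lp sp => [_ /(can_inj fK) xz'|a p /= /andP[xa ap] lp sp].
    by rewrite xz' eqxx in xz.
  exists (g a); first by rewrite -fmono gK.
  by rewrite -sp gK -lp ltnS dist_le.
by have [_ ->] := dist_unique D0 lip desc.
Qed.

Lemma isomorphic_radius_le (R : realType) (G H : sgraph) (f : G -> H) :
  bijective f -> (forall u v, dist (f u) (f v) = dist u v) -> (0 < #|G|)%N ->
  dist_lap_radius R G <= dist_lap_radius R H.
Proof.
move=> [g fK gK] fd G0; have [X X0 EX] := @radius_form_attained R G G0.
have H0 : (0 < #|H|)%N.
  by have [u _] := card_gt0P G0; apply/card_gt0P; exists (f u).
have := radius_form_le (X \o g) H0.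
rewrite -(lap_form_transfer fK gK) (norm_transfer fK gK).
suff -> : lap_form (fun u v => (dist (f u) (f v))%:R) X = dform X.
  by rewrite EX ler_pM2r // ler_pM2l.
by apply: eq_bigr => u _; apply: eq_bigr => v _; rewrite fd.
Qed.

(** Rayleigh quotient of the centred indicator of [u], as in [line_tr_lt]. *)
Lemma transmission_radius (R : realType) (G : sgraph) (u : G) :
  #|G|%:R * (\sum_v (dist u v)%:R) <= dist_lap_radius R G * (#|G|%:R - 1) :> R.
Proof.
have G0 : (0 < #|G|)%N by apply/card_gt0P; exists u.
have n0 : 0 < #|G|%:R :> R by rewrite ltr0n.
pose c : R := #|G|%:R^-1; pose e (v : G) : R := (v == u)%:R - c.
have := radius_form_le e G0.
have -> : dform e = 2 * \sum_v (dist u v)%:R.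
  rewrite /lap_form (bigD1 u) //=.
  transitivity (\sum_v (dist u v)%:R + \sum_(v | v != u) (dist u v)%:R : R); last first.
    rewrite [in RHS]mulr_natl mulr2n [X in _ = _ + X](bigD1 u) //=.
    by rewrite dist_refl add0r.
  congr (_ + _).
    apply: eq_bigr => v _; rewrite /e eqxx; case: eqP => [->|_] /=.
      by rewrite dist_refl mul0r.
    ring.
  apply: eq_bigr => v vu; rewrite (bigD1 u) //= big1 => [|v' v'u].
    by rewrite /e eqxx (negPf vu) dist_sym /=; ring.
  by rewrite /e (negPf vu) (negPf v'u) subrr expr0n mulr0.
have -> : \sum_v e v ^+ 2 = 1 - c.
  transitivity (\sum_v ((v == u)%:R * (1 - 2 * c) + c ^+ 2)).
    by apply: eq_bigr => v _; rewrite /e; case: eqP => _ /=; ring.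
  rewrite big_split /= -mulr_suml (bigD1 u) //= eqxx big1 => [|v /negPf -> //].
  have cG : #|(xpredT : pred G)| = #|G| by apply: eq_card.
  rewrite sumr_const cG -(mulr_natr (c ^+ 2)) addr0 /c /=.
  by field; rewrite gt_eqF.
move=> H; have : 2 * (\sum_v (dist u v)%:R) * #|G|%:R <=
   2 * dist_lap_radius R G * (1 - c) * #|G|%:R by rewrite ler_pM2r.
have -> : 2 * dist_lap_radius R G * (1 - c) * #|G|%:R =
   2 * (dist_lap_radius R G * (#|G|%:R - 1)).
  by rewrite /c; field; rewrite gt_eqF.
lra.
Qed.

Lemma radius_gt_transmission (R : realType) (G : sgraph) (u : G) :
  (1 < #|G|)%N -> #|G|%:R <= \sum_v (dist u v)%:R :> R ->
  \sum_v (dist u v)%:R + 1 < dist_lap_radius R G.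
Proof.
have := transmission_radius R u.
move: (dist_lap_radius R G) (\sum_v _) => l t H; rewrite -(ltr1n R) => n1 nt.
by rewrite -(@ltr_pM2r _ (#|G|%:R - 1)); nra.
Qed.

Section KiteEigenvector.
Variables (R : realType) (k m : nat).
Hypotheses (k0 : (0 < k)%N) (m0 : (0 < m)%N).
Local Notation K := (kite k.+1 m).
Local Notation lam := (dist_lap_radius R K).

(** The quotient of the kite by its twins is a path: position 0 holds the [k] clique vertices other
    than the root, position 1 the root (a boolean is read as a number), and the tail follows. *)
Definition kite_pos (a : K) : nat :=
  match a with inl i => (i == 0 :> nat) | inr j => j.+2 end.

Definition kite_weight (i : nat) : R := if i is 0 then k%:R else 1.

Lemma sum_kite_pos (F : nat -> R) :
  \sum_(a : K) F (kite_pos a) = \sum_(i < m.+2) kite_weight i * F i.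
Proof.
rewrite big_sumType /= big_ord_recl /= [RHS]big_ord_recl big_ord_recl /=.
rewrite (eq_bigr (fun=> F 0%N)) // sumr_const card_ord mul1r addrA.
rewrite [F 1%N + _]addrC mulr_natl; congr (_ + _).
by apply: eq_bigr => i _; rewrite mul1r.
Qed.

Lemma kite_pos_dist (a b : K) : kite_pos a != kite_pos b ->
  dist a b = natdist (kite_pos a) (kite_pos b).
Proof.
rewrite dist_kite // /kite_dist /natdist; case: a b => [i|i] [j|j] /=; lia.
Qed.

Lemma kite_pos_eq (a b : K) : kite_pos a = kite_pos b -> a != b ->
  kite_pos a = 0%N /\ kite_pos b = 0%N.
Proof.
case: a b => [i|i] [j|j] /=; try by lia.
  move=> E ij; suff : (i : nat) != j by lia.
  by apply: contraNneq ij => /val_inj ->.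
by move=> [/val_inj ->]; rewrite eqxx.
Qed.

Lemma dform_kite_pos (f : nat -> R) :
  dform (fun a : K => f (kite_pos a)) =
  lap_form (line_mx kite_weight) (fun i : 'I_m.+2 => f i).
Proof.
transitivity (\sum_(a : K) \sum_(b : K)
    (natdist (kite_pos a) (kite_pos b))%:R * (f (kite_pos a) - f (kite_pos b)) ^+ 2).
  apply: eq_bigr => a _; apply: eq_bigr => b _.
  have [->|ne] := eqVneq (kite_pos a) (kite_pos b); first by rewrite subrr expr0n !mulr0.
  by rewrite kite_pos_dist.
under eq_bigr => a _ do
  rewrite (sum_kite_pos (fun j =>
    (natdist (kite_pos a) j)%:R * (f (kite_pos a) - f j) ^+ 2)).
rewrite (sum_kite_pos (fun i => \sum_(j < m.+2) kite_weight j *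
   ((natdist i j)%:R * (f i - f j) ^+ 2))).
apply: eq_bigr => i _; rewrite mulr_sumr; apply: eq_bigr => j _.
by rewrite /line_mx; ring.
Qed.

Variable Y : K -> R.
Hypothesis Y0 : 0 < \sum_a Y a ^+ 2.
Hypothesis Ymax : dform Y = 2 * lam * \sum_a Y a ^+ 2.

Let K0 : (0 < #|K|)%N := proj1 (kite_connected m (ltn0Sn k)).

Lemma kite_eigen (a : K) : lam * Y a = \sum_b (dist a b)%:R * (Y a - Y b).
Proof.
have sym (u v : K) : (dist u v)%:R = (dist v u)%:R :> R by rewrite dist_sym.
have one (Z : K -> R) : \sum_u 1 * Z u ^+ 2 = \sum_u Z u ^+ 2.
  by apply: eq_bigr => u _; rewrite mul1r.
rewrite -(maximizer_eigenvector (om := fun=> 1) (l := lam) sym _ _ a) ?mul1r ?one // => Z.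
by rewrite one; exact: radius_form_le.
Qed.

(** Subtracting the eigenvalue equations of two adjacent twins of transmission [T] gives
    [(lam - (T + 1)) * (Y a - Y b) = 0], and [lam] exceeds [T + 1]. *)
Lemma kite_twins (a b : K) : kite_pos a = 0%N -> kite_pos b = 0%N -> Y a = Y b.
Proof.
move=> pa pb; have [->//|ab] := eqVneq a b.
have ba : b != a by rewrite eq_sym.
have dab : dist a b = 1%N.
  rewrite dist_kite // /kite_dist /natdist.
  by move: a b ab pa pb {ba} => [i|i] [j|j] //= ab _ _; rewrite (_ : (i : nat) != j) //;
    apply: contraNneq ab => /val_inj ->.
have dc c : c != a -> c != b -> dist a c = dist b c.
  move=> ca cb; rewrite !dist_kite // /kite_dist /natdist.
  move: a b ab pa pb c ca cb {ba dab} => [i|i] [j|j] //= _ pa pb [c|c] ca cb /=.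
    have /negPf -> : (i : nat) != c by apply: contraNneq ca => /val_inj ->.
    by have /negPf -> : (j : nat) != c by apply: contraNneq cb => /val_inj ->.
  by lia.
pose T : R := \sum_c (dist a c)%:R.
have tr : lam > T + 1.
  (* The tail vertex [e], at distance 2, makes up for the distance 0 from [a] to itself; all others
     are at least 1. *)
  have nT : #|K|%:R <= T.
    rewrite /T -natr_sum ler_nat.
    pose e : K := inr (Ordinal m0).
    have ea : e != a by apply: contra_eqN pa => /eqP <-.
    have ae : dist a e = 2%N by rewrite kite_pos_dist ?pa.
    rewrite -sum1_card (bigD1 a) //= (bigD1 e) //=.
    rewrite [leqRHS](bigD1 a) //= [X in (_ <= _ + X)%N](bigD1 e) //= ae dist_refl.
    rewrite add0n addnA leq_add2l; apply: leq_sum => c /andP[ca _].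
    rewrite lt0n; apply: contraNneq ca => ac.
    have [p [_ lp sp]] := dist_walk (proj2 (kite_connected m (ltn0Sn k)) a c).
    by move: sp lp; rewrite ac; case: p => //= _ ->.
  apply: radius_gt_transmission nT.
  by rewrite card_sum !card_ord; lia.
have E := kite_eigen a; have E' := kite_eigen b.
have : (lam - (T + 1)) * (Y a - Y b) = 0.
  suff : lam * Y a - lam * Y b = (T + 1) * (Y a - Y b) by lra.
  rewrite E E' -sumrB mulrDl mul1r /T mulr_suml.
  transitivity (\sum_c ((dist a c)%:R * (Y a - Y b) + (c == a)%:R * (Y a - Y b))).
    apply: eq_bigr => c _; have [->|ca] := eqVneq c a.
      by rewrite dist_refl (dist_sym b a) dab /=; ring.
    have [->|cb] := eqVneq c b; first by rewrite dist_refl /=; ring.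
    by rewrite dc // mulr0n mul0r addr0; ring.
  rewrite big_split /=; congr (_ + _); rewrite (bigD1 a) //= eqxx mul1r.
  by rewrite big1 ?addr0 // => c /negPf ->; rewrite mul0r.
by move/eqP; rewrite mulf_eq0 subr_eq0 gt_eqF //= subr_eq0 => /eqP.
Qed.

(** By [kite_twins] the eigenvector factors through [kite_pos], and the factor maximizes the form of
    the weighted path, so [line_maximizer_inj] separates distinct positions. *)
Lemma kite_injective (a b : K) : a != b -> Y a = Y b ->
  kite_pos a = 0%N /\ kite_pos b = 0%N.
Proof.
move=> ab Yab; have [|ne] := eqVneq (kite_pos a) (kite_pos b).
  by move=> /kite_pos_eq; apply.
pose twin : K := inl (lift ord0 (Ordinal k0)); pose root : K := inl ord0.
pose f i := if i is i'.+1 then if i' is j.+1 then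
  (if insub j is Some j' then Y (inr j') else 0) else Y root else Y twin.
have fE c : Y c = f (kite_pos c).
  case: c => [i|j] /=; last by rewrite valK.
  case: eqP => [i0|/eqP i0] /=; first by congr (Y (inl _)); exact: val_inj.
  by apply: kite_twins; rewrite //= (negPf i0).
have wf (h : nat -> R) : \sum_(i < m.+2) kite_weight i * h i ^+ 2 =
    \sum_(c : K) h (kite_pos c) ^+ 2 by rewrite (sum_kite_pos (fun i => h i ^+ 2)).
have om0 i : 0 < kite_weight i by case: i => [|i]; rewrite ?ltr0n ?ltr01.
have lmax (h : nat -> R) : lap_form (line_mx kite_weight) (fun i : 'I_m.+2 => h i) <=
    2 * lam * \sum_(i < m.+2) kite_weight i * h i ^+ 2.
  by rewrite (wf h) -dform_kite_pos; exact: radius_form_le.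
have fmax : lap_form (line_mx kite_weight) (fun i : 'I_m.+2 => f i) =
    2 * lam * \sum_(i < m.+2) kite_weight i * f i ^+ 2.
  rewrite (wf f) -dform_kite_pos; under [in RHS]eq_bigr => c _ do rewrite -fE.
  by rewrite -Ymax; apply: eq_bigr => u _; apply: eq_bigr => v _; rewrite -!fE.
have pos_lt c : (kite_pos c < m.+2)%N.
  by case: c => [i|j] /=; [case: eqP | rewrite !ltnS].
have fne : exists2 i, (i < m.+2)%N & f i != 0.
  have [c Yc] : exists c, Y c != 0.
    apply/existsP; rewrite -negb_forall; apply: contraTN Y0 => /forallP H.
    by rewrite big1 ?ltxx // => c _; rewrite (eqP (H c)) expr0n.
  by exists (kite_pos c); rewrite -?fE.
have inj := line_maximizer_inj om0 (isT : (1 < m.+2)%N) lmax fmax fne.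
move: ne; rewrite neq_ltn => /orP[] lt.
  by have := inj _ _ (introT andP (conj lt (pos_lt b))); rewrite -!fE Yab eqxx.
by have := inj _ _ (introT andP (conj lt (pos_lt a))); rewrite -!fE Yab eqxx.
Qed.

Lemma kite_class_card (a : K) : (#|[set b | Y b == Y a]| <= k)%N.
Proof.
have [pa|pa] := eqVneq (kite_pos a) 0%N; last first.
  rewrite (_ : [set b | _] = [set a]) ?cards1 //; apply/setP => b; rewrite !inE.
  apply/eqP/eqP => [E|->//]; apply/eqP; apply: contraNT pa => ba.
  by have [_ ->] := kite_injective ba E.
have tw : [set b | Y b == Y a] \subset
    [set (inl (lift ord0 i) : K) | i in [set: 'I_k]].
  apply/subsetP => b; rewrite inE => /eqP E.
  have : kite_pos b = 0%N.
    by have [->//|ba] := eqVneq b a; have [] := kite_injective ba E.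
  case: b {E} => [b|//] /=; case: (unliftP ord0 b) => [i ->|->] //= _.
  by apply: imset_f; rewrite inE.
apply: leq_trans (subset_leq_card tw) _.
by apply: leq_trans (leq_imset_card _ _) _; rewrite cardsT card_ord.
Qed.

End KiteEigenvector.

(** * The equality case *)

Lemma pair_weight_le (R : realFieldType) (V : finType) (D D' : V -> V -> nat) :
  (forall u v, D u v = D v u) -> (forall u v, D' u v = D' v u) ->
  (forall w : V -> V -> R, weight w ->
    (\sum_u \sum_v (D u v)%:R * w u v) / 2 <= (\sum_u \sum_v (D' u v)%:R * w u v) / 2) ->
  forall u v, (D u v <= D' u v)%N.
Proof.
move=> Dsym D'sym le_DD' u v.
pose w a b : R := ((a == u) && (b == v))%:R + ((a == v) && (b == u))%:R.
have ww : weight w.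
  split=> a b; last by rewrite addr_ge0 ?ler0n.
  by rewrite /w addrC ![(a == _) && _]andbC.
have one (E : V -> V -> nat) a b :
    \sum_a' \sum_b' (E a' b')%:R * ((a' == a) && (b' == b))%:R = (E a b)%:R :> R.
  rewrite (bigD1 a) //= (bigD1 b) //= !eqxx mulr1 big1 ?addr0; last first.
    by move=> b' /negPf ->; rewrite mulr0.
  rewrite big1 ?addr0 // => a' /negPf ->; rewrite big1 // => b' _.
  by rewrite mulr0.
have two (E : V -> V -> nat) : (forall a b, E a b = E b a) ->
    (\sum_a \sum_b (E a b)%:R * w a b) / 2 = (E u v)%:R :> R.
  move=> Esym; under eq_bigr => a _ do under eq_bigr => b _ do rewrite mulrDr.
  under eq_bigr => a _ do rewrite big_split /=.
  by rewrite big_split /= !one [E v u]Esym; field.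
by have := le_DD' w ww; rewrite !two // ler_nat.
Qed.

(** Both inequalities between the forms are equalities, so the transported vector is a top
    eigenvector of the kite. Its value classes are too small for [big_class], which leaves the
    pointwise comparison of distances. *)
Lemma kite_rigid (R : realType) (G : sgraph) (k m : nat) (f : G -> kite k.+1 m)
    (X : G -> R) (C : {set G}) :
  connected_graph G -> (0 < k)%N -> (0 < m)%N -> bijective f -> #|C| = k.+1 ->
  0 < \sum_u X u ^+ 2 ->
  dform X = 2 * dist_lap_radius R (kite k.+1 m) * \sum_u X u ^+ 2 ->
  dominated X C (fun w => (\sum_u \sum_v (dist u v)%:R * w u v) / 2)
                (fun w => (\sum_u \sum_v (dist (f u) (f v))%:R * w u v) / 2) ->
  {mono f : u v / sedge u v}.
Proof.
move=> conn k0 m0 [g fK gK] cardC X0 EX [le_form eq_form].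
have connK : connected_graph (kite k.+1 m) by exact: kite_connected.
pose Y := X \o g; have Yf u : Y (f u) = X u by rewrite /Y /= fK.
have Y0 : 0 < \sum_a Y a ^+ 2 by rewrite (norm_transfer fK gK).
have formY := lap_form_transfer fK gK X.
have le_max := @radius_form_le R _ Y (proj1 connK).
rewrite (norm_transfer fK gK) -EX -formY in le_max.
have le_form' : dform X <= lap_form (fun u v => (dist (f u) (f v))%:R) X.
  by rewrite -(@ler_pM2r _ 2^-1) ?invr_gt0 ?ltr0n.
have EXY : dform X = lap_form (fun u v => (dist (f u) (f v))%:R) X.
  by apply/eqP; rewrite eq_le le_form' le_max.
have EY : dform Y = 2 * dist_lap_radius R (kite k.+1 m) * \sum_a Y a ^+ 2.
  by rewrite (norm_transfer fK gK) -EX -formY EXY.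
have [[y ycard]|le_all] := eq_form (congr1 (fun x => x / 2) EXY).
  have := kite_class_card k0 m0 Y0 EY (f y).
  rewrite leqNgt => /negP[]; rewrite cardC in ycard; apply: leq_trans ycard _.
  rewrite -(card_imset _ (can_inj fK)); apply: subset_leq_card.
  by apply/subsetP => _ /imsetP[u + ->]; rewrite !inE !Yf.
have dle : forall u v, (dist u v <= dist (f u) (f v))%N.
  by apply: pair_weight_le le_all => u v; rewrite dist_sym.
have deq u v : X u != X v -> dist u v = dist (f u) (f v).
  move=> Xuv; pose gap a b : R :=
    ((dist (f a) (f b))%:R - (dist a b)%:R) * (X a - X b) ^+ 2.
  have gap0 a b : 0 <= gap a b by rewrite mulr_ge0 ?sqr_ge0 // subr_ge0 ler_nat.
  have gaps : \sum_a \sum_b gap a b = 0.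
    transitivity (lap_form (fun u v => (dist (f u) (f v))%:R) X - dform X).
      rewrite -sumrB; apply: eq_bigr => a _; rewrite -sumrB.
      by apply: eq_bigr => b _; rewrite /gap mulrBl.
    by rewrite EXY subrr.
  have /eqP := gaps.
  rewrite psumr_eq0 => [/allP /(_ u (mem_index_enum _)) /=|a _]; last exact: sumr_ge0.
  rewrite psumr_eq0 => [/allP /(_ v (mem_index_enum _)) /=|b _]; last exact: gap0.
  rewrite /gap mulf_eq0 sqrf_eq0 [X u - X v == 0]subr_eq0 (negPf Xuv) orbF subr_eq0.
  by rewrite eqr_nat => /eqP ->.
move=> u v; rewrite (sedgeE _ _ conn) (sedgeE _ _ connK) (can_eq fK).
have [//|uv] := eqVneq u v; rewrite /=.
(* Equal entries occur only at clique vertices other than the root, so [f u] and [f v] are adjacent,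
   and [dle] makes [u] and [v] adjacent too. *)
have [Xuv|Xuv] := eqVneq (X u) (X v); last by rewrite deq.
have fuv : f u != f v by rewrite (can_eq fK).
have [pu pv] : kite_pos (f u) = 0%N /\ kite_pos (f v) = 0%N.
  by apply: (kite_injective k0 m0 Y0 EY fuv); rewrite !Yf.
have d1 : (dist (f u) (f v) <= 1)%N.
  rewrite dist_kite // /kite_dist; case: (f u) pu => //= i _; case: (f v) pv => //= j _.
  by rewrite /natdist; case: (_ != _).
by rewrite d1 (leq_trans (dle u v) d1).
Qed.

(** * Clique numbers and conclusion *)

Lemma clique_number_attained (G : sgraph) :
  exists2 C : {set G}, clique C & #|C| = clique_number G.
Proof.
have [|C clC EC] := @eq_bigmax_cond _ (fun A : {set G} => clique A) (fun A => #|A|).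
  apply/card_gt0P; exists set0; rewrite unfold_in.
  by apply/forall_inP => x; rewrite inE.
by exists C.
Qed.

Lemma clique_le_number (G : sgraph) (A : {set G}) :
  clique A -> (#|A| <= clique_number G)%N.
Proof. exact: (@leq_bigmax_cond _ (fun A : {set G} => clique A) (fun A => #|A|)). Qed.

Lemma clique_number_gt0 (G : sgraph) : (0 < #|G|)%N -> (0 < clique_number G)%N.
Proof.
move=> /card_gt0P[x _]; rewrite -(cards1 x); apply: clique_le_number.
apply/forall_inP => y /set1P ->; apply/forall_inP => z /set1P ->.
by rewrite eqxx.
Qed.

Lemma clique_number_gt1 (G : sgraph) :
  connected_graph G -> (1 < #|G|)%N -> (1 < clique_number G)%N.
Proof.
move=> [_ conn] /card_gt1P[x [y [_ _ xy]]].
have /connectP[[|a p] /=] := conn x y; first by move=> _ yx; rewrite yx eqxx in xy.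
case/andP=> xa _ _; have ne : x != a by apply: contraTneq xa => ->; rewrite sedge_irr.
have <- : #|[set x; a]| = 2%N by rewrite cards2 ne.
apply: clique_le_number; apply/forall_inP => u /set2P[] ->;
  by apply/forall_inP => v /set2P[] ->; rewrite ?eqxx ?xa ?[sedge a x]sedge_sym ?xa ?implybT.
Qed.

Lemma complete_isomorphic (G : sgraph) (C : {set G}) (k : nat) (f : G -> kite k 0) :
  clique C -> (#|G| <= #|C|)%N -> bijective f -> {mono f : u v / sedge u v}.
Proof.
move=> clC GC [g fK _] u v.
have CT x : x \in C.
  have /eqP -> : C == setT by rewrite eqEcard subsetT cardsT.
  exact: in_setT.
have -> : sedge u v = (u != v).
  have [->|uv] := eqVneq u v; first by rewrite sedge_irr.
  by move: clC => /forall_inP/(_ u (CT u))/forall_inP/(_ v (CT v))/implyP/(_ uv).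
rewrite -(can_eq fK); case: (f u) => [i|[]//]; case: (f v) => [j|[]//] /=.
by congr (~~ _); apply/eqP/eqP => [->|[->]].
Qed.

Theorem theorem5p2 (R : realType) (n w : nat) (G : sgraph) :
  connected_graph G -> #|G| = n -> clique_number G = w ->
  dist_lap_radius R G <= dist_lap_radius R (kite w (n - w)) /\
  (dist_lap_radius R G = dist_lap_radius R (kite w (n - w)) <->
   isomorphic G (kite w (n - w))).
Proof.
move=> conn <-{n} wE; have [C clC cardC] := clique_number_attained G.
rewrite wE in cardC; have G0 := proj1 conn.
have w0 : (0 < w)%N by rewrite -wE clique_number_gt0.
have connK := kite_connected (#|G| - w) w0.
have C0 : (0 < #|C|)%N by rewrite cardC.
have [X X0 EX] := @radius_form_attained R G G0.
have := straighten_graph X conn clC C0; rewrite cardC => -[f [g fK gK] dom].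
have rad_le : dist_lap_radius R G <= dist_lap_radius R (kite w (#|G| - w)).
  have le_max := @radius_form_le R _ (X \o g) (proj1 connK).
  have le_form : dform X <= lap_form (fun u v => (dist (f u) (f v))%:R) X.
    by case: dom => H _; rewrite -(@ler_pM2r _ 2^-1) ?invr_gt0 ?ltr0n.
  rewrite -(lap_form_transfer fK gK) (norm_transfer fK gK) in le_max.
  have := le_trans le_form le_max.
  by rewrite EX ler_pM2r // ler_pM2l.
split=> //; split=> [rE|[h bij_h mono_h]]; last first.
  have dist_h := isomorphic_dist bij_h mono_h connK.
  apply/eqP; rewrite eq_le rad_le; have [h' hK h'K] := bij_h.
  apply: (@isomorphic_radius_le R _ _ h' _ _ (proj1 connK)); first by exists h.
  by move=> u v; rewrite -dist_h !h'K.
have bij_f : bijective f by exists g.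
exists f => //; rewrite rE in EX; clear rad_le rE connK.
(* Without a tail both graphs are complete and any bijection will do; [kite_rigid] handles a
   nonempty tail. *)
have [m0|m0] := posnP (#|G| - w)%N.
  have GC : (#|G| <= #|C|)%N by rewrite cardC -subn_eq0 m0.
  (* The tail length occurs in the type of [f], so it is generalised before being replaced by 0. *)
  move: (#|G| - w)%N m0 f g fK gK EX dom bij_f => m m0; rewrite m0 => f _ _ _ _ _.
  exact: complete_isomorphic clC GC.
have w1 : (1 < w)%N by rewrite -wE clique_number_gt1 //; lia.
case: w => [//|k] in w0 w1 wE cardC f g fK gK EX dom bij_f m0 *.
exact: kite_rigid bij_f cardC X0 EX dom.
Qed.
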